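(* The structural completion of each of the following deductive systems is hereditarily structurally complete: $\mathsf{KC}$, $\mathsf{M}_n$ (for every $n\ge 1$), $\mathsf{Bd}_1$, $\mathsf{G}_n$ (for every $n\geq 1$), $\mathsf{LC}$, $\mathsf{Sm}$.
   Context: Formulas are built from a countably infinite set of variables with the connectives $\wedge,\vee,\to,\neg$. A rule is a pair $\Gamma/A$ with $\Gamma$ a finite (possibly empty) set of formulas and $A$ a formula. A deductive system is a pair $S=\langle Ax,R\rangle$ of a nonempty set of formulas and a nonempty set of rules. For finite $\Gamma$, $\Gamma\vdash_S A$ means there is a sequence $B_1,\dots,B_n=A$ where each $B_i$ is in $\Gamma$, or is a substitution instance of a formula of $Ax$, or there is a substitution instance $\Delta/B_i$ of a rule in $R$ with $\Delta\subseteq\{B_1,\dots,B_{i-1}\}$. $L(S)=\{A:\ \vdash_S A\}$. $S'$ is a deductive extension of $S$ if $\vdash_S\subseteq\vdash_{S'}$. A rule $r$ is admissible in $S=\langle Ax,R\rangle$ if $L(\langle Ax,R\cup\{r\}\rangle)=L(S)$; $\Gamma/A$ is derivable in $S$ if $\Gamma\vdash_S A$. The structural completion of $S$ is $\langle Ax,\widetilde{R}(S)\rangle$, where $\widetilde{R}(S)$ is the set of all rules admissible in $S$. $S$ is structurally complete if every rule admissible in $S$ is derivable in $S$; it is hereditarily structurally complete if it is structurally complete and every deductive extension of it is structurally complete. Each named logic $L$ below is regarded as the deductive system $\langle L,\{\mathsf{mp}\}\rangle$, $\mathsf{mp}$ being Modus Ponens. $\mathsf{Int}$ is intuitionistic propositional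 logic; ''$\mathsf{Int}+A$'' is the least set of formulas containing $\mathsf{Int}$ and $A$ and closed under Modus Ponens and substitution. $\mathsf{KC}=\mathsf{Int}+(\neg p\vee\neg\neg p)$ (Yankov logic). $\mathsf{LC}=\mathsf{Int}+((p\to q)\vee(q\to p))$ (Gödel–Dummett logic). $\mathsf{Bd}_n$ is the logic of intuitionistic Kripke frames of depth at most $n$ (so $\mathsf{Bd}_1$ is classical logic). $\mathsf{G}_n$ is the Gödel logic of linearly ordered Kripke frames of depth at most $n$, i.e. the least logic containing $\mathsf{LC}$ and $\mathsf{Bd}_n$. $\mathsf{M}_n$ is the logic of rooted Kripke frames with at most $n$ maximal nodes. $\mathsf{Sm}=\mathsf{Int}+\big((\neg q\to p)\to(((p\to q)\to p)\to p)\big)$ is the Smetanich logic, the greatest logic extending $\mathsf{Int}$ that is properly contained in classical logic. *)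

(* Defs.v *)
From Stdlib Require Import List Sorted Arith.
Import ListNotations.

Inductive form : Type :=
| Var (i : nat)
| And (A B : form)
| Or (A B : form)
| Imp (A B : form)
| Neg (A : form).

Declare Scope form_scope.
Delimit Scope form_scope with form.
Bind Scope form_scope with form.
Infix "∧'" := And (at level 40, left associativity) : form_scope.
Infix "∨'" := Or (at level 50, left associativity) : form_scope.
Infix "→'" := Imp (at level 55, right associativity) : form_scope.
Notation "¬' A" := (Neg A) (at level 35, right associativity) : form_scope.
Open Scope form_scope.

Fixpoint subst (s : nat -> form) (A : form) : form :=
  match A with
  | Var i => s i
  | B ∧' C => subst s B ∧' subst s C
  | B ∨' C => subst s B ∨' subst s C
  | B →' C => subst s B →' subst s C
  | ¬' B => ¬' subst s B
  end.

(** * Deductive systems *)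

(** The finite set of premises is represented by a list; only membership in
    it is ever used. *)
Definition rule : Type := (list form * form)%type.

Record system : Type := System {
  ax : form -> Prop;
  rules : rule -> Prop;
  ax_nonempty : exists A, ax A;
  rules_nonempty : exists r, rules r
}.

Definition derivation (S : system) (Gamma l : list form) : Prop :=
  forall l1 B l2, l = l1 ++ B :: l2 ->
    In B Gamma
    \/ (exists s C, ax S C /\ B = subst s C)
    \/ (exists s r, rules S r /\ B = subst s (snd r) /\
          incl (map (subst s) (fst r)) l1).

Definition derives (S : system) (Gamma : list form) (A : form) : Prop :=
  exists l, derivation S Gamma (l ++ [A]).

Definition thms (S : system) (A : form) : Prop := derives S [] A.

Definition extension (S S' : system) : Prop :=
  forall Gamma A, derives S Gamma A -> derives S' Gamma A.

Definition derivable (S : system) (r : rule) : Prop :=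
  derives S (fst r) (snd r).

Lemma add_rule_nonempty (S : system) (r : rule) :
  exists r', rules S r' \/ r' = r.
Proof. exists r; now right. Qed.

Definition add_rule (S : system) (r : rule) : system :=
  System (ax S) (fun r' => rules S r' \/ r' = r)
    (ax_nonempty S) (add_rule_nonempty S r).

Definition admissible (S : system) (r : rule) : Prop :=
  forall A, thms (add_rule S r) A <-> thms S A.

Lemma rules_admissible (S : system) (r : rule) : rules S r -> admissible S r.
Proof.
  intros Hr A; split; intros [l Hl]; exists l; intros l1 B l2 E;
    destruct (Hl l1 B l2 E) as [H | [H | (s & r' & H & H')]]; auto;
    right; right; exists s, r'; split; auto.
  - destruct H as [H | ->]; assumption.
  - now left.
Qed.

Lemma admissible_nonempty (S : system) : exists r, admissible S r.
Proof.
  destruct (rules_nonempty S) as [r Hr]; exists r; now apply rules_admissible.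
Qed.

Definition structural_completion (S : system) : system :=
  System (ax S) (admissible S) (ax_nonempty S) (admissible_nonempty S).

Definition structurally_complete (S : system) : Prop :=
  forall r, admissible S r -> derivable S r.

Definition hereditarily_structurally_complete (S : system) : Prop :=
  structurally_complete S /\
  forall S', extension S S' -> structurally_complete S'.

Definition mp : rule := ([Var 0; Var 0 →' Var 1], Var 1).

(** The logic [L] regarded as the deductive system [<L, {mp}>]. *)
Definition mp_system (L : form -> Prop) (HL : exists A, L A) : system :=
  System L (fun r => r = mp) HL (ex_intro _ mp eq_refl).

(** * Axiomatically defined logics *)

Inductive Int : form -> Prop :=
| Int_K A B : Int (A →' B →' A)
| Int_S A B C : Int ((A →' B →' C) →' (A →' B) →' A →' C)
| Int_and_l A B : Int (A ∧' B →' A)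
| Int_and_r A B : Int (A ∧' B →' B)
| Int_and_i A B : Int (A →' B →' A ∧' B)
| Int_or_l A B : Int (A →' A ∨' B)
| Int_or_r A B : Int (B →' A ∨' B)
| Int_or_e A B C : Int ((A →' C) →' (B →' C) →' A ∨' B →' C)
| Int_neg_i A B : Int ((A →' B) →' (A →' ¬' B) →' ¬' A)
| Int_neg_e A B : Int (¬' A →' A →' B)
| Int_mp A B : Int A -> Int (A →' B) -> Int B.

Inductive Int_plus (X : form) : form -> Prop :=
| plus_Int A : Int A -> Int_plus X A
| plus_ax : Int_plus X X
| plus_mp A B : Int_plus X A -> Int_plus X (A →' B) -> Int_plus X B
| plus_subst s A : Int_plus X A -> Int_plus X (subst s A).

Definition KC : form -> Prop := Int_plus (¬' Var 0 ∨' ¬' ¬' Var 0).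

Definition LC : form -> Prop :=
  Int_plus ((Var 0 →' Var 1) ∨' (Var 1 →' Var 0)).

Definition Sm : form -> Prop :=
  let p := Var 0 in let q := Var 1 in
  Int_plus ((¬' q →' p) →' ((p →' q) →' p) →' p).

(** * Logics defined by Kripke frames *)

Record frame : Type := Frame {
  world :> Type;
  le : world -> world -> Prop;
  world_inhabited : inhabited world;
  le_refl : forall x, le x x;
  le_trans : forall x y z, le x y -> le y z -> le x z;
  le_antisym : forall x y, le x y -> le y x -> x = y
}.
Arguments le {f}.

Definition lt {F : frame} (x y : F) : Prop := le x y /\ x <> y.

Definition persistent {F : frame} (V : nat -> F -> Prop) : Prop :=
  forall i x y, le x y -> V i x -> V i y.

Fixpoint forces {F : frame} (V : nat -> F -> Prop) (x : F) (A : form) : Prop :=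
  match A with
  | Var i => V i x
  | B ∧' C => forces V x B /\ forces V x C
  | B ∨' C => forces V x B \/ forces V x C
  | B →' C => forall y, le x y -> forces V y B -> forces V y C
  | ¬' B => forall y, le x y -> ~ forces V y B
  end.

Definition valid (F : frame) (A : form) : Prop :=
  forall V : nat -> F -> Prop, persistent V -> forall x, forces V x A.

Definition logic_of (P : frame -> Prop) (A : form) : Prop :=
  forall F, P F -> valid F A.

Definition depth_le (n : nat) (F : frame) : Prop :=
  forall l : list F, StronglySorted lt l -> length l <= n.

Definition linear (F : frame) : Prop := forall x y : F, le x y \/ le y x.

Definition rooted (F : frame) : Prop := exists r : F, forall x, le r x.

Definition maximal {F : frame} (x : F) : Prop := forall y, le x y -> y = x.

Definition at_most_n_maximal (n : nat) (F : frame) : Prop :=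
  forall l : list F, NoDup l -> (forall x, In x l -> maximal x) ->
  length l <= n.

(** Every finite frame is topped.  Without this condition an infinite frame
    could have at most [n] maximal nodes merely for lack of maximal nodes:
    replacing the maximal nodes of a finite frame by copies of the chain of
    natural numbers leaves no maximal node and refutes the same formulas. *)
Definition topped (F : frame) : Prop :=
  forall x : F, exists m, le x m /\ maximal m.

Definition Bd (n : nat) : form -> Prop := logic_of (depth_le n).

Definition G (n : nat) : form -> Prop :=
  logic_of (fun F => linear F /\ depth_le n F).

Definition M (n : nat) : form -> Prop :=
  logic_of (fun F => rooted F /\ topped F /\ at_most_n_maximal n F).

(** * The deductive systems *)

Lemma Int_plus_nonempty (X : form) : exists A, Int_plus X A.
Proof. exists X; apply plus_ax. Qed.

Lemma logic_of_nonempty (P : frame -> Prop) : exists A, logic_of P A.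
Proof. exists (Var 0 →' Var 0); intros F _ V _ x y _ H; exact H. Qed.

Definition KC_system : system := mp_system KC (Int_plus_nonempty _).
Definition LC_system : system := mp_system LC (Int_plus_nonempty _).
Definition Sm_system : system := mp_system Sm (Int_plus_nonempty _).
Definition Bd_system (n : nat) : system := mp_system (Bd n) (logic_of_nonempty _).
Definition G_system (n : nat) : system := mp_system (G n) (logic_of_nonempty _).
Definition M_system (n : nat) : system := mp_system (M n) (logic_of_nonempty _).

(* Main.v *)
Require Import Defs.
From Stdlib Require Import List Arith Lia Cantor Classical ClassicalEpsilon
  FunctionalExtensionality PropExtensionality ProofIrrelevance.
Import ListNotations.

(** The projective formulas behind admissibility are built from types, the sets
    of formulas of a finite subformula-closed set [Phi] forced at a node.  Call a
    set [W] of types containing [A] good if every subset [X] of [W] has a tight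
    predecessor in [W]: the type of a node placed directly below nodes realizing
    [X].  Let [P_W] say that all nodes above have a type in [W].  For good [W] the
    formula [P_W] is projective: Ghilardi's substitutions, sending [p] to
    [P_W -> p] or to [P_W /\ p], leave the nodes forcing [P_W] unchanged, and a
    round of them raises the least number of types of [W] realized above a node
    that does not force [P_W], so boundedly many rounds unify [P_W].

    If [s A] is in one of the logics then so is the disjunction of the [s P_W]
    over good [W].  For linear models the types above a node are good, since the
    node with the least type in [X] serves as tight predecessor.  For [KC] and
    [M_n] one may add to a frame a node directly below any nonempty set together
    with a new root; doing so while it realizes new types ends with a good set.

    Hence in an extension of the completion, [A] derives the disjunction of the
    [P_W], and an admissible rule [A/C] yields each [P_W -> C] by projectivity. *)

(** * Kripke semantics *)

Lemma forces_persistent (F : frame) (V : nat -> F -> Prop) A x y :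
  persistent V -> le x y -> forces V x A -> forces V y A.
Proof.
  intros HV; revert x y; induction A as [i|A IHA B IHB|A IHA B IHB|A IHA B IHB|A IHA];
    simpl; intros x y Hxy H.
  - eapply HV; eauto.
  - destruct H; split; eauto.
  - destruct H; eauto.
  - intros z Hz; apply H; eapply le_trans; eauto.
  - intros z Hz; apply H; eapply le_trans; eauto.
Qed.

Lemma Int_sound (F : frame) (V : nat -> F -> Prop) A :
  persistent V -> Int A -> forall x, forces V x A.
Proof.
  intros HV H; induction H; intros x; simpl.
  - intros y Hxy HA z Hyz _; eapply forces_persistent; eauto.
  - intros y _ H1 z Hyz H2 t Hzt H3; apply (H1 t) with (y := t);
      eauto using le_trans, le_refl.
  - tauto.
  - tauto.
  - intros y _ HA z Hyz HB; split; eauto using forces_persistent.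
  - tauto.
  - tauto.
  - intros y _ H1 z Hyz H2 t Hzt [H3|H3]; [apply H1 | apply H2];
      eauto using le_trans.
  - intros y _ H1 z Hyz H2 t Hzt H3; apply (H2 t) with (y := t);
      eauto using le_trans, le_refl.
  - intros y _ H1 z Hyz H2; exfalso; exact (H1 z Hyz H2).
  - apply (IHInt2 x x (le_refl _ x)), IHInt1.
Qed.

Definition subst_val {F : frame} (V : nat -> F -> Prop) (s : nat -> form) :
  nat -> F -> Prop := fun i x => forces V x (s i).

Lemma subst_val_persistent (F : frame) (V : nat -> F -> Prop) s :
  persistent V -> persistent (subst_val V s).
Proof. intros HV i x y Hxy; unfold subst_val; now apply forces_persistent. Qed.

Lemma forces_subst (F : frame) (V : nat -> F -> Prop) s A x :
  forces V x (subst s A) <-> forces (subst_val V s) x A.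
Proof.
  revert x; induction A; simpl; intros x; unfold subst_val; try tauto.
  - rewrite IHA1, IHA2; tauto.
  - rewrite IHA1, IHA2; tauto.
  - split; intros H y Hy; specialize (H y Hy); rewrite IHA1, IHA2 in *; tauto.
  - split; intros H y Hy; specialize (H y Hy); rewrite IHA in *; tauto.
Qed.

(** The language has no constants; a theorem and a contradiction in the variable 0 stand in for
    truth and falsity. *)
Definition top : form := Var 0 →' Var 0.
Definition bot : form := Var 0 ∧' ¬' Var 0.
Definition bigand (l : list form) : form := fold_right And top l.
Definition bigor (l : list form) : form := fold_right Or bot l.

Lemma forces_bigand (F : frame) (V : nat -> F -> Prop) l x :
  forces V x (bigand l) <-> forall A, In A l -> forces V x A.
Proof.
  induction l as [|B l IH]; simpl.
  - split; [tauto | intros _ y _ H; exact H].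
  - rewrite IH; split; [intros [H1 H2] A [->|H]; auto | auto].
Qed.

Lemma forces_bigor (F : frame) (V : nat -> F -> Prop) l x :
  forces V x (bigor l) <-> exists A, In A l /\ forces V x A.
Proof.
  induction l as [|B l IH]; simpl.
  - split; [intros [H1 H2]; exfalso; exact (H2 x (le_refl _ x) H1) | intros (A & [] & _)].
  - rewrite IH; split.
    + intros [H|(A & H1 & H2)]; eauto.
    + intros (A & [->|H1] & H2); eauto.
Qed.

(** * Prime theories and canonical models *)

(** No substitution rule is included, so the members of [T] act as fixed hypotheses and the
    deduction theorem holds. *)
Inductive cn (T : form -> Prop) : form -> Prop :=
| cn_hyp A : T A -> cn T A
| cn_Int A : Int A -> cn T A
| cn_mp A B : cn T A -> cn T (A →' B) -> cn T B.

Definition extend (T : form -> Prop) (D : form) : form -> Prop :=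
  fun E => T E \/ E = D.

Definition prime (T : form -> Prop) : Prop :=
  (forall A, cn T A -> T A) /\ (exists C, ~ T C) /\
  (forall A B, T (A ∨' B) -> T A \/ T B).

Lemma Int_id A : Int (A →' A).
Proof.
  apply Int_mp with (A →' A →' A); [apply Int_K|].
  apply Int_mp with (A →' (A →' A) →' A); [apply Int_K | apply Int_S].
Qed.

Lemma cn_weaken (T : form -> Prop) A B : cn T B -> cn T (A →' B).
Proof. intros H; eapply cn_mp; [exact H | apply cn_Int, Int_K]. Qed.

Lemma cn_mono (T U : form -> Prop) A :
  (forall B, T B -> U B) -> cn T A -> cn U A.
Proof. intros HTU H; induction H; eauto using cn. Qed.

Lemma cn_deduction T A B : cn (extend T A) B -> cn T (A →' B).
Proof.
  intros H; induction H as [B [H| ->]|B H|B C H1 IH1 H2 IH2].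
  - now apply cn_weaken, cn_hyp.
  - apply cn_Int, Int_id.
  - now apply cn_weaken, cn_Int.
  - eapply cn_mp; [exact IH1|]; eapply cn_mp; [exact IH2|]; apply cn_Int, Int_S.
Qed.

Lemma cn_or_elim T A B C :
  cn (extend T A) C -> cn (extend T B) C -> cn T (A ∨' B) -> cn T C.
Proof.
  intros H1 H2 H3; apply (cn_mp _ _ _ H3).
  eapply cn_mp; [apply cn_deduction, H2|].
  eapply cn_mp; [apply cn_deduction, H1|]; apply cn_Int, Int_or_e.
Qed.

Lemma cn_absurd T A B : cn T A -> cn T (¬' A) -> cn T B.
Proof.
  intros H1 H2; apply (cn_mp _ _ _ H1); apply (cn_mp _ _ _ H2).
  apply cn_Int, Int_neg_e.
Qed.

Lemma cn_neg_intro T A : cn (extend T A) (¬' A) -> cn T (¬' A).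
Proof.
  intros H; apply cn_deduction in H; apply (cn_mp _ _ _ H).
  apply cn_mp with (A →' A); apply cn_Int; [apply Int_id | apply Int_neg_i].
Qed.

(* Lindenbaum's construction of prime theories *)
#[local] Opaque to_nat.

Fixpoint code (A : form) : nat :=
  match A with
  | Var i => to_nat (0, i)
  | B ∧' C => to_nat (1, to_nat (code B, code C))
  | B ∨' C => to_nat (2, to_nat (code B, code C))
  | B →' C => to_nat (3, to_nat (code B, code C))
  | ¬' B => to_nat (4, code B)
  end.

Lemma code_inj A B : code A = code B -> A = B.
Proof.
  revert B; induction A; intros []; cbn [code]; intros H; apply to_nat_inj in H;
    try discriminate; apply (f_equal snd) in H; cbn [snd] in H;
    [congruence | apply to_nat_inj in H .. | f_equal; auto]; f_equal;
    [apply IHA1 | apply IHA2 | apply IHA1 | apply IHA2 | apply IHA1 | apply IHA2];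
    [exact (f_equal fst H) | exact (f_equal snd H) | exact (f_equal fst H)
    |exact (f_equal snd H) | exact (f_equal fst H) | exact (f_equal snd H)].
Qed.

Fixpoint lindenbaum (T : form -> Prop) (C : form) (n : nat) : form -> Prop :=
  match n with
  | 0 => T
  | S n => fun D => lindenbaum T C n D \/
             (code D = n /\ ~ cn (extend (lindenbaum T C n) D) C)
  end.

Lemma lindenbaum_mono T C n m A :
  n <= m -> lindenbaum T C n A -> lindenbaum T C m A.
Proof. intros H; induction H; simpl; auto. Qed.

(** By injectivity of [code] a stage adds at most one formula, and it adds it only if [C] stays
    underivable. *)
Lemma lindenbaum_avoids T C n : ~ cn T C -> ~ cn (lindenbaum T C n) C.
Proof.
  intros HT; induction n as [|n IH]; simpl; [exact HT|].
  destruct (classic (exists D, code D = n /\ ~ cn (extend (lindenbaum T C n) D) C))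
    as [(D & HD & HD')|HD].
  - intros H; apply HD'; revert H; apply cn_mono.
    intros B [H|[H _]]; [now left|right; apply code_inj; congruence].
  - intros H; apply IH; revert H; apply cn_mono.
    intros B [H|H]; [exact H|exfalso; eauto].
Qed.

(** The union of the stages is maximal among the theories not deriving [C], because every formula is
    considered at the stage given by its code. Maximality yields closure and the disjunction
    property. *)
Lemma prime_extension T C :
  ~ cn T C -> exists U, prime U /\ (forall A, T A -> U A) /\ ~ U C.
Proof.
  intros HT; set (U := fun D => exists n, lindenbaum T C n D).
  (* A derivation uses finitely many hypotheses, so it already lives at one stage. *)
  assert (Hfin : forall A, cn U A -> exists n, cn (lindenbaum T C n) A).
  { intros A H; induction H as [A [n H]|A H|A B _ [n H1] _ [m H2]].
    - exists n; now apply cn_hyp.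
    - exists 0; now apply cn_Int.
    - exists (n + m); apply cn_mp with A.
      + revert H1; apply cn_mono; intros D; apply lindenbaum_mono; lia.
      + revert H2; apply cn_mono; intros D; apply lindenbaum_mono; lia. }
  assert (HU : ~ cn U C).
  { intros H; destruct (Hfin _ H) as [n Hn]; exact (lindenbaum_avoids T C n HT Hn). }
  assert (Hmax : forall D, ~ U D -> cn (extend U D) C).
  { intros D HD; apply NNPP; intros H; apply HD; exists (S (code D)); right.
    split; [reflexivity|]; intros H'; apply H; revert H'; apply cn_mono.
    intros B [HB|HB]; [left; now exists (code D) | now right]. }
  exists U; split; [split; [|split]|split].
  - intros A HA; apply NNPP; intros H; apply HU.
    apply cn_mp with A; [exact HA|]; apply cn_deduction, Hmax, H.
  - exists C; intros H; now apply HU, cn_hyp.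
  - intros A B HAB; apply NNPP; intros H; apply HU.
    apply (cn_or_elim U A B); [apply Hmax; tauto .. | now apply cn_hyp].
  - intros A HA; now exists 0.
  - intros H; now apply HU, cn_hyp.
Qed.

(** Keeping only the theories above [T0] gives a frame with root [T0]; instances of an axiom in [T0]
    can then be split by primeness of [T0] to get conditions on the whole frame. *)
Definition cworld (T0 : form -> Prop) : Type :=
  {T : form -> Prop | prime T /\ forall A, T0 A -> T A}.

Definition canonical (T0 : form -> Prop) (H0 : prime T0) : frame.
Proof.
  refine (Frame (cworld T0) (fun x y => forall A, proj1_sig x A -> proj1_sig y A)
            _ _ _ _).
  - constructor; exists T0; auto.
  - auto.
  - auto.
  - intros [x Hx] [y Hy] Hxy Hyx; apply subset_eq_compat; simpl in *.
    extensionality A; apply propositional_extensionality; split; auto.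
Defined.

Definition cval T0 H0 : nat -> canonical T0 H0 -> Prop :=
  fun i x => proj1_sig x (Var i).

Lemma cval_persistent T0 H0 : persistent (cval T0 H0).
Proof. intros i x y Hxy; apply Hxy. Qed.

(** If a theory omits [A →' B] or [¬' A], a prime extension contains [A] and omits [B], respectively
    [¬' A]; this is the world refuting the implication or negation. *)
Lemma truth_lemma T0 H0 A (x : canonical T0 H0) :
  forces (cval T0 H0) x A <-> proj1_sig x A.
Proof.
  revert x; induction A as [i|A IHA B IHB|A IHA B IHB|A IHA B IHB|A IHA];
    intros [T [HT HT0]]; simpl; try rewrite IHA; try rewrite IHB; simpl.
  - reflexivity.
  - destruct HT as [HT _]; split.
    + intros [H1 H2]; apply HT.
      eapply cn_mp; [apply cn_hyp, H2|]; eapply cn_mp; [apply cn_hyp, H1|].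
      apply cn_Int, Int_and_i.
    + intros H; split; apply HT; (eapply cn_mp; [apply cn_hyp, H|]); apply cn_Int;
        constructor.
  - destruct HT as (HT & _ & HT'); split; [|apply HT'].
    intros [H|H]; apply HT; (eapply cn_mp; [apply cn_hyp, H|]); apply cn_Int;
      constructor.
  - split.
    + intros H; apply (proj1 HT), cn_deduction, NNPP; intros HB.
      destruct (prime_extension _ _ HB) as (U & HU & HTU & HUB).
      assert (HU0 : prime U /\ forall A, T0 A -> U A)
        by (split; [exact HU | intros D HD; apply HTU; left; auto]).
      specialize (H (exist _ U HU0)); rewrite IHA, IHB in H; apply HUB, H.
      * intros D HD; apply HTU; now left.
      * apply HTU; now right.
    + intros H [U [HU HU0]] HTU; rewrite IHA, IHB; simpl in *; intros HA.
      apply (proj1 HU); eapply cn_mp; apply cn_hyp; eauto.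
  - split.
    + intros H; apply (proj1 HT), cn_neg_intro, NNPP; intros HB.
      destruct (prime_extension _ _ HB) as (U & HU & HTU & HUB).
      assert (HU0 : prime U /\ forall A, T0 A -> U A)
        by (split; [exact HU | intros D HD; apply HTU; left; auto]).
      apply (H (exist _ U HU0)).
      * intros D HD; apply HTU; now left.
      * apply IHA, HTU; now right.
    + intros H [U [HU HU0]] HTU; rewrite IHA; simpl in *; intros HA.
      destruct HU as (HU & [C HC] & _); apply HC, HU.
      apply cn_absurd with A; apply cn_hyp; auto.
Qed.

Lemma canonical_refutes (L : form -> Prop) B :
  (forall A, Int A -> L A) -> (forall A C, L A -> L (A →' C) -> L C) ->
  ~ L B -> exists T0, prime T0 /\ (forall A, L A -> T0 A) /\ ~ T0 B.
Proof.
  intros HI Hmp HB; apply prime_extension; intros H; apply HB.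
  clear HB; induction H; eauto.
Qed.

(** Allows intuitionistic theorems to be checked on Kripke models instead of being derived in the
    calculus. *)
Lemma Int_complete A :
  (forall (F : frame) (V : nat -> F -> Prop), persistent V ->
     forall x, forces V x A) -> Int A.
Proof.
  intros H; apply NNPP; intros HA.
  destruct (canonical_refutes Int A) as (T0 & H0 & _ & HT0);
    [auto | intros B C; apply Int_mp | exact HA |].
  apply HT0, (truth_lemma T0 H0 A (exist _ T0 (conj H0 (fun _ H => H)))).
  apply H, cval_persistent.
Qed.

(** * Types of nodes *)

Definition pfilter {A : Type} (P : A -> Prop) (l : list A) : list A :=
  filter (fun a => if excluded_middle_informative (P a) then true else false) l.

Lemma in_pfilter {A : Type} (P : A -> Prop) l a :
  In a (pfilter P l) <-> In a l /\ P a.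
Proof.
  unfold pfilter; rewrite filter_In.
  destruct (excluded_middle_informative (P a)); intuition discriminate.
Qed.

Lemma pfilter_ext {A : Type} (P Q : A -> Prop) l :
  (forall a, In a l -> (P a <-> Q a)) -> pfilter P l = pfilter Q l.
Proof.
  intros H; apply filter_ext_in; intros a Ha; specialize (H a Ha).
  destruct (excluded_middle_informative (P a)), (excluded_middle_informative (Q a));
    tauto.
Qed.

Lemma length_pfilter_le {A : Type} (P Q : A -> Prop) l :
  (forall a, In a l -> P a -> Q a) -> length (pfilter P l) <= length (pfilter Q l).
Proof.
  induction l as [|b l IH]; simpl; intros H; [lia|].
  specialize (IH (fun a Ha => H a (or_intror Ha))).
  specialize (H b (or_introl eq_refl)).
  destruct (excluded_middle_informative (P b)), (excluded_middle_informative (Q b));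
    simpl; unfold pfilter in *; try tauto; lia.
Qed.

Lemma length_pfilter_lt {A : Type} (P Q : A -> Prop) l a :
  (forall a, In a l -> P a -> Q a) -> In a l -> Q a -> ~ P a ->
  length (pfilter P l) < length (pfilter Q l).
Proof.
  intros HPQ Ha HQ HP; apply in_split in Ha as (l1 & l2 & ->).
  pose proof (length_pfilter_le P Q l1) as H1.
  pose proof (length_pfilter_le P Q l2) as H2.
  unfold pfilter in *; rewrite !filter_app, !length_app; simpl.
  destruct (excluded_middle_informative (P a)); [tauto|].
  destruct (excluded_middle_informative (Q a)); [|tauto]; simpl.
  assert (forall b, In b l1 -> P b -> Q b) by (intros; apply HPQ; auto with datatypes).
  assert (forall b, In b l2 -> P b -> Q b) by (intros; apply HPQ; auto with datatypes).
  specialize (H1 H); specialize (H2 H0); lia.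
Qed.

Fixpoint sublists {A : Type} (l : list A) : list (list A) :=
  match l with
  | [] => [[]]
  | a :: l => map (cons a) (sublists l) ++ sublists l
  end.

Lemma pfilter_sublists {A : Type} (P : A -> Prop) l :
  In (pfilter P l) (sublists l).
Proof.
  induction l as [|a l IH]; simpl; [now left|].
  apply in_app_iff; destruct (excluded_middle_informative (P a)); [left|now right].
  now apply in_map.
Qed.

Lemma sublists_incl {A : Type} (l u : list A) : In u (sublists l) -> incl u l.
Proof.
  revert u; induction l as [|a l IH]; simpl; intros u H.
  - destruct H as [<-|[]]; apply incl_refl.
  - apply in_app_iff in H as [H|H].
    + apply in_map_iff in H as (v & <- & H).
      apply incl_cons; [now left | apply incl_tl; auto].
    + apply incl_tl; auto.
Qed.

Definition closed (Phi : list form) : Prop :=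
  forall B, In B Phi ->
  match B with
  | Var _ => True
  | C ∧' D | C ∨' D | C →' D => In C Phi /\ In D Phi
  | ¬' C => In C Phi
  end.

Fixpoint subformulas (A : form) : list form :=
  A :: match A with
       | Var _ => []
       | B ∧' C | B ∨' C | B →' C => subformulas B ++ subformulas C
       | ¬' B => subformulas B
       end.

Lemma subformulas_self A : In A (subformulas A).
Proof. destruct A; now left. Qed.

Lemma subformulas_closed A : closed (subformulas A).
Proof.
  induction A as [i|A IHA B IHB|A IHA B IHB|A IHA B IHB|A IHA];
    intros D [<-|HD]; cbn [subformulas] in *; try easy.
  all: pose proof subformulas_self as S.
  1, 3, 5: split; right; apply in_app_iff; auto.
  - apply in_app_iff in HD as [HD|HD]; [apply IHA in HD | apply IHB in HD];
      destruct D; try split; try (apply in_cons, in_app_iff); tauto.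
  - apply in_app_iff in HD as [HD|HD]; [apply IHA in HD | apply IHB in HD];
      destruct D; try split; try (apply in_cons, in_app_iff); tauto.
  - apply in_app_iff in HD as [HD|HD]; [apply IHA in HD | apply IHB in HD];
      destruct D; try split; try (apply in_cons, in_app_iff); tauto.
  - right; auto.
  - apply IHA in HD; destruct D; try split; try apply in_cons; tauto.
Qed.

(** A list filtered out of [Phi] rather than a predicate, so that nodes of different models forcing
    the same formulas of [Phi] get equal types, finitely many in all. *)
Definition typ {F : frame} (Phi : list form) (V : nat -> F -> Prop) (x : F) :
  list form := pfilter (forces V x) Phi.

(* Normalising each sublist by [pfilter] makes extensionally equal types equal
   even when [Phi] has repetitions. *)
Definition all_types (Phi : list form) : list (list form) :=
  map (fun u => pfilter (fun B => In B u) Phi) (sublists Phi).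

Lemma typ_all_types (F : frame) Phi (V : nat -> F -> Prop) x :
  In (typ Phi V x) (all_types Phi).
Proof.
  apply in_map_iff; exists (typ Phi V x); split; [|apply pfilter_sublists].
  apply pfilter_ext; intros B HB; unfold typ; rewrite in_pfilter; tauto.
Qed.

Lemma in_typ (F : frame) Phi (V : nat -> F -> Prop) x B :
  In B (typ Phi V x) <-> In B Phi /\ forces V x B.
Proof. apply in_pfilter. Qed.

Lemma typ_eq (F G : frame) Phi (V : nat -> F -> Prop) (U : nat -> G -> Prop) x y :
  (forall B, In B Phi -> (forces V x B <-> forces U y B)) ->
  typ Phi V x = typ Phi U y.
Proof. apply pfilter_ext. Qed.

Lemma typ_forces (F G : frame) Phi (V : nat -> F -> Prop) (U : nat -> G -> Prop) x y B :
  typ Phi V x = typ Phi U y -> In B Phi -> forces V x B -> forces U y B.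
Proof.
  intros E HB H; apply (in_typ _ Phi U); rewrite <- E; now apply in_typ.
Qed.

Lemma typ_eq_type (F : frame) Phi (V : nat -> F -> Prop) x w :
  In w (all_types Phi) ->
  (forall B, In B Phi -> (forces V x B <-> In B w)) -> typ Phi V x = w.
Proof.
  intros Hw H; apply in_map_iff in Hw as (u & <- & Hu).
  apply pfilter_ext; intros B HB; rewrite (H B HB), in_pfilter; tauto.
Qed.

(** * Tight predecessors *)

(* [w] is the type of a node placed directly below nodes realizing the types
   in [X]. *)
Definition tight (Phi : list form) (X : list form -> Prop) (w : list form) : Prop :=
  forall B, In B Phi ->
  match B with
  | Var _ => In B w -> forall u, X u -> In B u
  | C ∧' D => In B w <-> In C w /\ In D w
  | C ∨' D => In B w <-> In C w \/ In D w
  | C →' D => In B w <-> (forall u, X u -> In B u) /\ (In C w -> In D w)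
  | ¬' C => In B w <-> (forall u, X u -> In B u) /\ ~ In C w
  end.

(** Above [x] there are only nodes of its own type and nodes above a witness of [X]. The former
    cannot refute an implication or negation that passes the local test at [x], the latter cannot by
    persistence. *)
Lemma tight_typ (F : frame) Phi (V : nat -> F -> Prop) (x : F) (X : list form -> Prop) :
  closed Phi -> persistent V ->
  (forall u, X u -> exists z, le x z /\ typ Phi V z = u) ->
  (forall z, le x z -> typ Phi V z = typ Phi V x \/
     exists z0, X (typ Phi V z0) /\ le z0 z) ->
  tight Phi X (typ Phi V x).
Proof.
  intros HPhi HV H1 H2.
  assert (Hup : forall B u, In B (typ Phi V x) -> X u -> In B u).
  { intros B u HB Hu; destruct (H1 u Hu) as (z & Hz & <-).
    rewrite in_typ in *; destruct HB; split; eauto using forces_persistent. }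
  intros B HB; pose proof (HPhi B HB) as Hsub.
  destruct B as [i|C D|C D|C D|C].
  - auto.
  - rewrite !in_typ; simpl; tauto.
  - rewrite !in_typ; simpl; tauto.
  - split.
    + intros H; split; [intros u; now apply Hup|].
      rewrite !in_typ in *; intros [_ HC]; split; [tauto|].
      apply (proj2 H); [apply le_refl | exact HC].
    + intros [HX HCD]; apply in_typ; split; [exact HB|]; intros z Hz HC.
      destruct (H2 z Hz) as [E|(z0 & Hz0 & Hle)].
      * rewrite <- E in HCD; rewrite !in_typ in HCD; tauto.
      * apply HX, in_typ in Hz0 as [_ Hz0]; exact (Hz0 z Hle HC).
  - split.
    + intros H; split; [intros u; now apply Hup|].
      rewrite !in_typ in *; intros [_ HC]; apply (proj2 H x); [apply le_refl | exact HC].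
    + intros [HX HC]; apply in_typ; split; [exact HB|]; intros z Hz HCz.
      destruct (H2 z Hz) as [E|(z0 & Hz0 & Hle)].
      * rewrite <- E in HC; rewrite !in_typ in HC; tauto.
      * apply HX, in_typ in Hz0 as [_ Hz0]; exact (Hz0 z Hle HCz).
Qed.

(** By persistence the type of [y] includes that of [x], so any further formula would make it
    strictly longer. *)
Lemma typ_eq_of_length (F : frame) Phi (V : nat -> F -> Prop) x y :
  persistent V -> le x y -> length (typ Phi V y) <= length (typ Phi V x) ->
  typ Phi V x = typ Phi V y.
Proof.
  intros HV Hxy Hl; apply typ_eq; intros B HB; split.
  - now apply forces_persistent.
  - intros Hy; apply NNPP; intros Hx.
    enough (length (typ Phi V x) < length (typ Phi V y)) by lia.
    apply length_pfilter_lt with B; auto.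
    intros C _; now apply forces_persistent.
Qed.

(** Types grow upwards and are bounded by [Phi], so the climb stops. The type reached is a tight
    predecessor of the empty set. *)
Lemma stable_node (F : frame) Phi (V : nat -> F -> Prop) (x : F) :
  persistent V ->
  exists y, le x y /\ forall z, le y z -> typ Phi V z = typ Phi V y.
Proof.
  intros HV; remember (length Phi - length (typ Phi V x)) as n eqn:En.
  revert x En; induction n as [n IH] using (well_founded_induction lt_wf); intros x ->.
  destruct (classic (exists z, le x z /\ length (typ Phi V x) < length (typ Phi V z)))
    as [(z & Hxz & Hlt)|H].
  - destruct (IH (length Phi - length (typ Phi V z))) with (x := z) as (y & Hy & Hy').
    + assert (length (typ Phi V z) <= length Phi) by apply filter_length_le; lia.
    + reflexivity.
    + exists y; split; [eapply le_trans; eauto | exact Hy'].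
  - exists x; split; [apply le_refl|]; intros z Hz; symmetry.
    apply typ_eq_of_length; auto; apply Nat.nlt_ge; eauto.
Qed.

(** * Projective formulas *)

(** For empty [X] the second clause asks for a type that obeys the classical truth tables on
    [Phi]. *)
Definition good (Phi : list form) (A : form) (W : list (list form)) : Prop :=
  (forall w, In w W -> In A w) /\
  (forall X : list form -> Prop, (forall u, X u -> In u W) ->
     exists w, In w W /\ tight Phi X w).

(** The conjunct for a type [w] outside [W] says that forcing all of [w] entails forcing some member
    of [Phi] not in [w]; this excludes exactly [w] as the type of a node above. *)
Definition PW (Phi : list form) (W : list (list form)) : form :=
  bigand (map (fun w => bigand w →' bigor (pfilter (fun B => ~ In B w) Phi))
            (pfilter (fun w => ~ In w W) (all_types Phi))).

Lemma forces_PW (F : frame) Phi W (V : nat -> F -> Prop) x :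
  persistent V ->
  forces V x (PW Phi W) <-> forall y, le x y -> In (typ Phi V y) W.
Proof.
  intros HV; unfold PW; rewrite forces_bigand; split.
  - intros H y Hxy; apply NNPP; intros Hn.
    specialize (H _ (in_map _ _ _ (proj2 (in_pfilter _ _ _)
      (conj (typ_all_types F Phi V y) Hn)))).
    specialize (H y Hxy); rewrite forces_bigand, forces_bigor in H.
    destruct H as (B & HB & HB').
    + intros B HB; apply in_typ in HB; tauto.
    + rewrite in_pfilter, in_typ in HB; tauto.
  - intros H A HA; apply in_map_iff in HA as (w & <- & Hw).
    apply in_pfilter in Hw as [Hw HW]; intros y Hxy Hy.
    rewrite forces_bigand in Hy; rewrite forces_bigor.
    apply NNPP; intros Hn; apply HW.
    rewrite <- (typ_eq_type F Phi V y w Hw); auto.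
    intros B HB; split; [|auto].
    intros HB'; apply NNPP; intros HBw; apply Hn; exists B; split; auto.
    apply in_pfilter; auto.
Qed.

Lemma typ_of_PW (F : frame) Phi W (V : nat -> F -> Prop) x :
  persistent V -> forces V x (PW Phi W) -> In (typ Phi V x) W.
Proof. intros HV H; exact (proj1 (forces_PW F Phi W V x HV) H x (le_refl _ x)). Qed.

(** * Ghilardi's substitutions and their action on valuations *)

Definition theta (P : form) (w : list form) (i : nat) : form :=
  if excluded_middle_informative (In (Var i) w) then P →' Var i else P ∧' Var i.

(** The head of the list is the outermost substitution, so on valuations it acts first, in agreement
    with [upds]. *)
Fixpoint thetas (P : form) (l : list (list form)) : nat -> form :=
  match l with
  | [] => Var
  | w :: l => fun i => subst (theta P w) (thetas P l i)
  end.

Definition upd {F : frame} (P : form) (w : list form) (V : nat -> F -> Prop) :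
  nat -> F -> Prop := subst_val V (theta P w).

Definition upds {F : frame} (P : form) (l : list (list form)) (V : nat -> F -> Prop) :
  nat -> F -> Prop := fold_left (fun V w => upd P w V) l V.

Lemma subst_compose s t A : subst s (subst t A) = subst (fun i => subst s (t i)) A.
Proof. induction A; simpl; congruence. Qed.

Lemma subst_Var A : subst Var A = A.
Proof. induction A; simpl; congruence. Qed.

Lemma forces_thetas (F : frame) P l (V : nat -> F -> Prop) x A :
  forces V x (subst (thetas P l) A) <-> forces (upds P l V) x A.
Proof.
  revert V; induction l as [|w l IH]; intros V; simpl.
  - now rewrite subst_Var.
  - rewrite <- subst_compose, forces_subst; apply IH.
Qed.

Lemma upds_persistent (F : frame) P l (V : nat -> F -> Prop) :
  persistent V -> persistent (upds P l V).
Proof.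
  revert V; induction l as [|w l IH]; simpl; intros V HV; [exact HV|].
  now apply IH, subst_val_persistent.
Qed.

Lemma forces_agree (F : frame) (V U : nat -> F -> Prop) x A :
  (forall i y, le x y -> (V i y <-> U i y)) -> forces V x A <-> forces U x A.
Proof.
  revert x; induction A as [i|A IHA B IHB|A IHA B IHB|A IHA B IHB|A IHA];
    simpl; intros x H.
  - apply H, le_refl.
  - rewrite (IHA x H), (IHB x H); tauto.
  - rewrite (IHA x H), (IHB x H); tauto.
  - split; intros H' y Hy; specialize (H' y Hy);
      (rewrite IHA, IHB in * || rewrite <- IHA, <- IHB in *); eauto using le_trans.
  - split; intros H' y Hy; specialize (H' y Hy);
      (rewrite IHA in * || rewrite <- IHA in * ); eauto using le_trans.
Qed.

Lemma theta_inside (F : frame) P w (V : nat -> F -> Prop) x i :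
  persistent V -> forces V x P -> upd P w V i x <-> V i x.
Proof.
  intros HV H; unfold upd, subst_val, theta.
  destruct (excluded_middle_informative _); simpl; [|tauto].
  split; [intros H'; apply H'; [apply le_refl | exact H]|].
  intros H' y Hy _; eapply HV; eauto.
Qed.

Lemma upds_inside (F : frame) P l (V : nat -> F -> Prop) x A :
  persistent V -> forces V x P -> forces (upds P l V) x A <-> forces V x A.
Proof.
  revert V A; induction l as [|w l IH]; simpl; intros V A HV H; [tauto|].
  assert (Hw : forall B, forces (upd P w V) x B <-> forces V x B).
  { intros B; apply forces_agree; intros i y Hy.
    apply theta_inside; eauto using forces_persistent. }
  rewrite IH, Hw; [tauto | now apply subst_val_persistent | now apply Hw].
Qed.

Lemma upds_inside_typ (F : frame) P l Phi (V : nat -> F -> Prop) x :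
  persistent V -> forces V x P -> typ Phi (upds P l V) x = typ Phi V x.
Proof. intros HV H; apply typ_eq; intros B _; now apply upds_inside. Qed.

(** Only nodes forcing [PW] count: their types lie in [W] and survive every update. *)
Definition realized {F : frame} Phi W (V : nat -> F -> Prop) (x : F) (u : list form) :
  Prop := exists y, le x y /\ forces V y (PW Phi W) /\ typ Phi V y = u.

Definition front {F : frame} Phi W (V : nat -> F -> Prop) (x : F)
  (X : list form -> Prop) : Prop :=
  forall y, le x y -> ~ forces V y (PW Phi W) -> forall u, realized Phi W V y u <-> X u.

(** Outside [P] the formula [P ∧' Var i] fails, while [P →' Var i] only asks about the nodes above
    that force [P]. *)
Lemma theta_outside (F : frame) P w (V : nat -> F -> Prop) x i :
  ~ forces V x P ->
  upd P w V i x <-> In (Var i) w /\ forall z, le x z -> forces V z P -> V i z.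
Proof.
  intros H; unfold upd, subst_val, theta.
  destruct (excluded_middle_informative _); simpl; tauto.
Qed.

Lemma realized_upds (F : frame) Phi W l (V : nat -> F -> Prop) x u :
  persistent V -> realized Phi W V x u -> realized Phi W (upds (PW Phi W) l V) x u.
Proof.
  intros HV (y & Hxy & Hy & <-); exists y; split; [exact Hxy|]; split.
  - now apply upds_inside.
  - now apply upds_inside_typ.
Qed.

(** An inside node above one outside node is matched by an inside node of the same type above the
    other, and updates do not change inside types. Outside nodes are compared with each other by
    induction on the formula. *)
Lemma front_uniform (F : frame) Phi W v (V : nat -> F -> Prop) x X B :
  closed Phi -> persistent V -> front Phi W V x X -> In B Phi ->
  forall y z, le x y -> le x z ->
  ~ forces V y (PW Phi W) -> ~ forces V z (PW Phi W) ->
  forces (upd (PW Phi W) v V) y B -> forces (upd (PW Phi W) v V) z B.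
Proof.
  intros HPhi HV HX; set (P := PW Phi W) in *.
  assert (HV' : persistent (upd P v V)) by now apply subst_val_persistent.
  assert (Hmatch : forall y z t, le x y -> le x z -> ~ forces V y P -> ~ forces V z P ->
            le z t -> forces V t P -> exists s, le y s /\ forces V s P /\
              typ Phi V s = typ Phi V t).
  { intros y z t Hy Hz Hyn Hzn Hzt Ht.
    destruct (proj2 (HX y Hy Hyn (typ Phi V t))) as (s & Hs).
    - apply (HX z Hz Hzn); exists t; auto.
    - exists s; tauto. }
  assert (Htyp : forall s t, forces V s P -> forces V t P ->
            typ Phi V s = typ Phi V t -> typ Phi (upd P v V) s = typ Phi (upd P v V) t).
  { intros s t Hs Ht E.
    now rewrite !(upds_inside_typ F P [v] Phi V) by assumption. }
  induction B as [i|C IHC D IHD|C IHC D IHD|C IHC D IHD|C IHC];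
    intros HB y z Hy Hz Hyn Hzn; pose proof (HPhi _ HB) as Hsub.
  - simpl; rewrite !theta_outside by assumption; intros [Hv H]; split; [exact Hv|].
    intros t Hzt Ht; destruct (Hmatch y z t) as (s & Hys & Hs & E); auto.
    apply (typ_forces F F Phi V V s t (Var i) E HB), H; auto.
  - destruct Hsub; simpl; intros []; split; eauto.
  - destruct Hsub; simpl; intros []; eauto.
  - destruct Hsub as [HC HD]; intros H t Hzt HCt.
    destruct (classic (forces V t P)) as [Ht|Ht].
    + destruct (Hmatch y z t) as (s & Hys & Hs & E); auto.
      apply (typ_forces F F Phi _ _ s t D (Htyp s t Hs Ht E) HD), H; auto.
      exact (typ_forces F F Phi _ _ t s C (eq_sym (Htyp s t Hs Ht E)) HC HCt).
    (* With [t] outside, carry [C] from [t] down to [y], use the implication at [y] itself, and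
       carry [D] back to [t]. *)
    + apply (IHD HD y t); eauto using le_trans.
      apply H; [apply le_refl|]; apply (IHC HC t y); eauto using le_trans.
  - intros H t Hzt HCt.
    destruct (classic (forces V t P)) as [Ht|Ht].
    + destruct (Hmatch y z t) as (s & Hys & Hs & E); auto.
      apply (H s Hys).
      exact (typ_forces F F Phi _ _ t s C (eq_sym (Htyp s t Hs Ht E)) Hsub HCt).
    + apply (H y (le_refl _ y)); apply (IHC Hsub t y); eauto using le_trans.
Qed.

(** If some outside node above [x] enters [PW], uniformity gives all remaining ones its type, so [x]
    enters as well. If none enters, the set of realized types is unchanged. *)
Lemma front_step (F : frame) Phi W v (V : nat -> F -> Prop) x X :
  closed Phi -> persistent V -> front Phi W V x X ->
  forces (upd (PW Phi W) v V) x (PW Phi W) \/ front Phi W (upd (PW Phi W) v V) x X.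
Proof.
  intros HPhi HV HX; set (P := PW Phi W) in *.
  assert (HV' : persistent (upd P v V)) by now apply subst_val_persistent.
  assert (Hin : forall y, forces V y P -> forces (upd P v V) y P)
    by (intros y Hy; now apply (upds_inside F P [v])).
  destruct (classic (exists y, le x y /\ ~ forces V y P /\ forces (upd P v V) y P))
    as [(y & Hxy & Hyn & Hy)|Hn].
  - left; apply (forces_PW F Phi W _ x HV'); intros z Hxz.
    destruct (classic (forces V z P)) as [Hz|Hz].
    + apply typ_of_PW; [exact HV' | now apply Hin].
    + replace (typ Phi (upd P v V) z) with (typ Phi (upd P v V) y)
        by (apply typ_eq; intros B HB; split; apply front_uniform with x X; auto).
      now apply typ_of_PW.
  - assert (Hiff : forall y, le x y -> (forces (upd P v V) y P <-> forces V y P)).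
    { intros y Hy; split; [|apply Hin]; intros H; apply NNPP; intros H'; apply Hn; eauto. }
    right; intros y Hy Hyn u; fold P in Hyn; rewrite (Hiff y Hy) in Hyn.
    rewrite <- (HX y Hy Hyn u); split; [|now apply (realized_upds F Phi W [v])].
    intros (z & Hyz & Hz & <-); exists z; split; [exact Hyz|].
    apply Hiff in Hz; [|eauto using le_trans]; split; [exact Hz|].
    symmetry; now apply (upds_inside_typ F P [v]).
Qed.

(** The update gives every outside node above [x] exactly the type [w]: the clauses of [tight] match
    the forcing clauses at a node that sees [X] inside and otherwise only nodes of type [w]. *)
Lemma front_tight (F : frame) Phi W w (V : nat -> F -> Prop) x X :
  closed Phi -> persistent V -> front Phi W V x X ->
  In w W -> In w (all_types Phi) -> tight Phi X w ->
  forces (upd (PW Phi W) w V) x (PW Phi W).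
Proof.
  intros HPhi HV HX HwW Hw Htight; set (P := PW Phi W) in *.
  assert (HV' : persistent (upd P w V)) by now apply subst_val_persistent.
  assert (Hin : forall y, forces V y P -> typ Phi (upd P w V) y = typ Phi V y)
    by (intros y Hy; now apply (upds_inside_typ F P [w])).
  assert (Hout : forall B, In B Phi -> forall y, le x y -> ~ forces V y P ->
            forces (upd P w V) y B <-> In B w).
  (* Translates the condition on [X] in [tight] into one on the inside nodes above [y]. *)
  { assert (Habove : forall y B, le x y -> ~ forces V y P -> In B Phi ->
              ((forall u, X u -> In B u) <->
               forall z, le y z -> forces V z P -> forces (upd P w V) z B)).
    { intros y B Hy Hyn HB; split.
      - intros H z Hyz Hz; eapply in_typ; rewrite Hin by exact Hz; apply H.
        apply (HX y Hy Hyn); exists z; auto.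
      - intros H u Hu; apply (HX y Hy Hyn) in Hu as (z & Hyz & Hz & <-).
        rewrite <- Hin by exact Hz; apply in_typ; auto. }
    intros B; induction B as [i|C IHC D IHD|C IHC D IHD|C IHC D IHD|C IHC];
      intros HB y Hy Hyn; pose proof (HPhi _ HB) as Hsub; pose proof (Htight _ HB) as Ht.
    - simpl; rewrite theta_outside by assumption; split; [tauto|].
      intros Hi; split; [exact Hi|]; intros z Hyz Hz.
      apply (theta_inside F P w V z i HV Hz).
      exact (proj1 (Habove y (Var i) Hy Hyn HB) (Ht Hi) z Hyz Hz).
    - destruct Hsub; rewrite Ht; simpl; rewrite IHC, IHD by assumption; tauto.
    - destruct Hsub; rewrite Ht; simpl; rewrite IHC, IHD by assumption; tauto.
    - destruct Hsub as [HC HD]; rewrite Ht, (Habove y _ Hy Hyn HB); split.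
      + intros H; split.
        * intros z Hyz _; eapply forces_persistent; eauto.
        * rewrite <- (IHC HC y), <- (IHD HD y) by assumption; apply H, le_refl.
      + intros [H1 H2] z Hyz HCz; destruct (classic (forces V z P)) as [Hz|Hz].
        * apply (H1 z Hyz Hz z); [apply le_refl | exact HCz].
        * rewrite IHC in HCz by eauto using le_trans.
          rewrite IHD by eauto using le_trans; auto.
    - rewrite Ht, (Habove y _ Hy Hyn HB); split.
      + intros H; split.
        * intros z Hyz _; eapply forces_persistent; eauto.
        * rewrite <- (IHC Hsub y) by assumption; apply H, le_refl.
      + intros [H1 H2] z Hyz HCz; destruct (classic (forces V z P)) as [Hz|Hz].
        * apply (H1 z Hyz Hz z); [apply le_refl | exact HCz].
        * rewrite IHC in HCz by eauto using le_trans; auto. }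
  apply (forces_PW F Phi W _ x HV'); intros z Hxz.
  destruct (classic (forces V z P)) as [Hz|Hz].
  - rewrite Hin by exact Hz; now apply typ_of_PW.
  - rewrite (typ_eq_type F Phi (upd P w V) z w); auto.
Qed.

(** Updates preceding [w] put [x] inside or keep it in [front] position, [w] itself puts it inside,
    and later updates leave inside nodes alone. *)
Lemma front_round (F : frame) Phi W w (V : nat -> F -> Prop) x X l :
  closed Phi -> persistent V -> front Phi W V x X ->
  In w W -> In w (all_types Phi) -> tight Phi X w -> In w l ->
  forces (upds (PW Phi W) l V) x (PW Phi W).
Proof.
  intros HPhi HV HX HwW Hw Ht; revert V HV HX.
  induction l as [|v l IH]; simpl; intros V HV HX; [tauto|]; intros Hl.
  assert (HV' : persistent (upd (PW Phi W) v V)) by now apply subst_val_persistent.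
  destruct Hl as [->|Hl].
  - apply upds_inside; [exact HV'|now apply front_tight with X ..].
  - destruct (front_step F Phi W v V x X) as [H|H]; auto.
    now apply upds_inside.
Qed.

Definition rank {F : frame} Phi W (V : nat -> F -> Prop) (x : F) : nat :=
  length (pfilter (realized Phi W V x) (all_types Phi)).

(* If no node outside [PW] realizes fewer than [k] types, then a node outside
   realizing exactly [k] types is in [front] position, and one round over all
   types puts it inside. *)
Lemma round_rank (F : frame) Phi A W (V : nat -> F -> Prop) k :
  closed Phi -> persistent V -> good Phi A W -> incl W (all_types Phi) ->
  (forall x, ~ forces V x (PW Phi W) -> k <= rank Phi W V x) ->
  forall x, ~ forces (upds (PW Phi W) (all_types Phi) V) x (PW Phi W) ->
  S k <= rank Phi W (upds (PW Phi W) (all_types Phi) V) x.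
Proof.
  intros HPhi HV [_ HW] HWT Hk x Hx; apply Nat.nlt_ge; intros Hlt.
  assert (HxV : ~ forces V x (PW Phi W)) by (intros H; now apply Hx, upds_inside).
  (* Updates never lose a realized type, so the old rank of [x] is at most the new one. *)
  assert (Hle : rank Phi W V x <= k).
  { apply Nat.le_trans with (rank Phi W (upds (PW Phi W) (all_types Phi) V) x); [|lia].
    apply length_pfilter_le; intros u _; now apply realized_upds. }
  destruct (HW (realized Phi W V x)) as (w & HwW & Hw).
  { intros u (y & _ & Hy & <-); now apply typ_of_PW. }
  apply Hx, front_round with w (realized Phi W V x); auto.
  intros y Hxy Hy u; split.
  - intros (z & Hz & Hz'); exists z; eauto using le_trans.
  (* A type realized above [x] but not above [y] would give [y] a rank below [k]. *)
  - intros Hu; apply NNPP; intros Hnu; specialize (Hk y Hy).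
    enough (rank Phi W V y < rank Phi W V x) by lia.
    apply length_pfilter_lt with u; auto.
    + intros v _ (z & Hz & Hz'); exists z; eauto using le_trans.
    + destruct Hu as (z & _ & _ & <-); apply typ_all_types.
Qed.

Definition rounds (Phi : list form) (n : nat) : list (list form) :=
  concat (repeat (all_types Phi) n).

Lemma upds_app (F : frame) P l1 l2 (V : nat -> F -> Prop) :
  upds P (l1 ++ l2) V = upds P l2 (upds P l1 V).
Proof. apply fold_left_app. Qed.

Lemma rounds_rank (F : frame) Phi A W n (V : nat -> F -> Prop) k :
  closed Phi -> persistent V -> good Phi A W -> incl W (all_types Phi) ->
  (forall x, ~ forces V x (PW Phi W) -> k <= rank Phi W V x) ->
  forall x, ~ forces (upds (PW Phi W) (rounds Phi n) V) x (PW Phi W) ->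
  n + k <= rank Phi W (upds (PW Phi W) (rounds Phi n) V) x.
Proof.
  intros HPhi HV HW HWT; revert V HV k; induction n as [|n IH]; intros V HV k Hk.
  - exact Hk.
  - unfold rounds; simpl; rewrite upds_app, plus_n_Sm; apply IH.
    + now apply upds_persistent.
    + now apply round_rank with A.
Qed.

(** A rank never exceeds the number of types, so one round more than that leaves no node outside
    [PW]. *)
Definition unifier (Phi : list form) (W : list (list form)) : nat -> form :=
  thetas (PW Phi W) (rounds Phi (S (length (all_types Phi)))).

Lemma unifier_unifies Phi A W :
  closed Phi -> good Phi A W -> incl W (all_types Phi) ->
  Int (subst (unifier Phi W) (PW Phi W)).
Proof.
  intros HPhi HW HWT; apply Int_complete; intros F V HV x.
  apply forces_thetas, NNPP; intros H.
  apply rounds_rank with (A := A) (k := 0) in H; auto with arith.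
  unfold rank at 1 in H.
  assert (length (pfilter (realized Phi W
    (upds (PW Phi W) (rounds Phi (S (length (all_types Phi)))) V) x) (all_types Phi))
    <= length (all_types Phi)) by apply filter_length_le.
  lia.
Qed.

(** Where [PW] is forced, the updates change nothing. *)
Lemma unifier_projective Phi W A :
  Int (PW Phi W →' subst (unifier Phi W) A →' A).
Proof.
  apply Int_complete; intros F V HV x y Hxy Hy z Hyz.
  unfold unifier; rewrite forces_thetas, upds_inside; eauto using forces_persistent.
Qed.

Lemma PW_implies Phi A W : In A Phi -> good Phi A W -> Int (PW Phi W →' A).
Proof.
  intros HA [HW _]; apply Int_complete; intros F V HV x y _ Hy.
  apply typ_of_PW in Hy; [|exact HV].
  apply HW, in_typ in Hy; tauto.
Qed.

(** * Projective approximations are admissible consequences *)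

Definition approx (Phi : list form) (A : form) : list (list (list form)) :=
  pfilter (good Phi A) (sublists (all_types Phi)).

Definition cover (Phi : list form) (A : form) : form :=
  bigor (map (PW Phi) (approx Phi A)).

(** [D] will be the cone of a node for linear models and the whole frame in the gluing argument. *)
Definition realized_types {F : frame} Phi (V : nat -> F -> Prop) (D : F -> Prop) :
  list (list form) :=
  pfilter (fun u => exists x, D x /\ typ Phi V x = u) (all_types Phi).

Lemma in_realized_types (F : frame) Phi (V : nat -> F -> Prop) D u :
  In u (realized_types Phi V D) <-> exists x, D x /\ typ Phi V x = u.
Proof.
  unfold realized_types; rewrite in_pfilter; split; [tauto|].
  intros H; split; [|exact H]; destruct H as (x & _ & <-); apply typ_all_types.
Qed.

Lemma forces_cover (F : frame) Phi A (V : nat -> F -> Prop) (D : F -> Prop) x :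
  persistent V -> (forall y, le x y -> D y) ->
  good Phi A (realized_types Phi V D) -> forces V x (cover Phi A).
Proof.
  intros HV HD HW; apply forces_bigor.
  exists (PW Phi (realized_types Phi V D)); split.
  - apply in_map, in_pfilter; split; [apply pfilter_sublists | exact HW].
  - apply (forces_PW F Phi _ V x HV); intros y Hy; apply in_realized_types; eauto.
Qed.

(** * Covers in linear models *)

Definition linear_above {F : frame} (x : F) : Prop :=
  forall y z, le x y -> le x z -> le y z \/ le z y.

Lemma exists_shortest (F : frame) Phi (V : nat -> F -> Prop) (D : F -> Prop) y :
  D y -> exists x, D x /\ forall z, D z -> length (typ Phi V x) <= length (typ Phi V z).
Proof.
  remember (length (typ Phi V y)) as n eqn:En; revert y En.
  induction n as [n IH] using (well_founded_induction lt_wf); intros y -> Hy.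
  destruct (classic (exists z, D z /\ length (typ Phi V z) < length (typ Phi V y)))
    as [(z & Hz & Hlt)|H]; [eauto|].
  exists y; split; [exact Hy|]; intros z Hz; apply Nat.nlt_ge; eauto.
Qed.

Lemma cover_linear (F : frame) Phi A (V : nat -> F -> Prop) x :
  closed Phi -> In A Phi -> persistent V -> linear_above x ->
  (forall y, forces V y A) -> forces V x (cover Phi A).
Proof.
  intros HPhi HAPhi HV Hlin HA; apply forces_cover with (le x); auto; split.
  - intros u Hu; apply in_realized_types in Hu as (y & _ & <-); now apply in_typ.
  - intros X HX.
    destruct (classic (exists y, le x y /\ X (typ Phi V y))) as [(y & Hy)|Hn].
    (* Types on a chain are nested, so a shortest type in [X] is the least one. *)
    + destruct (exists_shortest F Phi V (fun y => le x y /\ X (typ Phi V y)) y Hy)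
        as (z & [Hxz Hz] & Hmin).
      exists (typ Phi V z); split; [apply in_realized_types; eauto|].
      apply tight_typ; auto.
      * intros u Hu; pose proof (HX u Hu) as Hu'.
        apply in_realized_types in Hu' as (t & Hxt & <-).
        destruct (Hlin z t Hxz Hxt) as [Hzt|Htz]; [eauto|].
        (* Here [t] lies below [z], and minimality of [z] makes their types agree. *)
        exists z; split; [apply le_refl|]; symmetry; apply typ_eq_of_length; auto.
      * intros t Hzt; right; eauto.
    + destruct (stable_node F Phi V x HV) as (y & Hxy & Hy).
      exists (typ Phi V y); split; [apply in_realized_types; eauto|].
      apply tight_typ; auto.
      intros u Hu; exfalso; apply Hn; pose proof (HX u Hu) as Hu'.
      apply in_realized_types in Hu' as (t & Hxt & <-); eauto.
Qed.

(** * Gluing a new node below a set of nodes *)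

Inductive ext_world (F : Type) : Type :=
| root
| glue
| old (x : F).
Arguments root {F}.
Arguments glue {F}.
Arguments old {F} x.

Definition ext_le {F : frame} (X : F -> Prop) (a b : ext_world F) : Prop :=
  match a, b with
  | root, _ => True
  | glue, glue => True
  | glue, old y => exists x, X x /\ le x y
  | old x, old y => le x y
  | _, _ => False
  end.

(* A node [glue] directly below [X], and a new root below everything. *)
Definition ext (F : frame) (X : F -> Prop) : frame.
Proof.
  refine (Frame (ext_world F) (ext_le X) (inhabits root) _ _ _).
  - intros []; simpl; auto using le_refl.
  - intros [| |x] [| |y] [| |z]; simpl; try tauto.
    + intros (t & Ht & Hty) Hyz; eauto using le_trans.
    + apply le_trans.
  - intros [] []; simpl; try tauto; intros H1 H2; f_equal; now apply le_antisym.
Defined.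

Definition ext_val {F : frame} (X : F -> Prop) (V : nat -> F -> Prop) :
  nat -> ext F X -> Prop :=
  fun i a => match a with old x => V i x | _ => False end.

Lemma ext_val_persistent (F : frame) (X : F -> Prop) (V : nat -> F -> Prop) :
  persistent V -> persistent (ext_val X V).
Proof. intros HV i [] []; simpl; try tauto; apply HV. Qed.

Lemma forces_old (F : frame) (X : F -> Prop) (V : nat -> F -> Prop)
  (U : nat -> ext F X -> Prop) A x :
  (forall i y, U i (old y) <-> V i y) -> forces U (old x : ext F X) A <-> forces V x A.
Proof.
  intros HU; revert x; induction A as [i|A IHA B IHB|A IHA B IHB|A IHA B IHB|A IHA];
    intros x; simpl.
  - apply HU.
  - rewrite IHA, IHB; tauto.
  - rewrite IHA, IHB; tauto.
  - split.
    + intros H y Hy; rewrite <- IHA, <- IHB; now apply H.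
    + intros H [| |y]; simpl; try tauto; rewrite IHA, IHB; apply H.
  - split.
    + intros H y Hy; rewrite <- IHA; now apply H.
    + intros H [| |y]; simpl; try tauto; rewrite IHA; apply H.
Qed.

(** Nonemptiness of [X] keeps [glue] from becoming a new maximal node, which could break the bound
    on maximal nodes and would break directedness. *)
Definition ext_closed (K : frame -> Prop) : Prop :=
  forall (F : frame) (X : F -> Prop), K F -> (exists x, X x) -> K (ext F X).

(* While the realized types are not good, gluing a node below the witnesses of
   a set without tight predecessor realizes a new type. *)
Lemma cover_ext_closed (K : frame -> Prop) Phi A s :
  ext_closed K -> closed Phi -> In A Phi ->
  (forall F, K F -> valid F (subst s A)) ->
  forall F, K F -> valid F (subst s (cover Phi A)).
Proof.
  intros HK HPhi HAPhi HA F HF V HV x.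
  (* The induction is on the number of types realized nowhere in the model. *)
  remember (length (pfilter (fun u => ~ exists y, True /\ typ Phi (subst_val V s) y = u)
    (all_types Phi))) as n eqn:En.
  revert F HF V HV x En; induction n as [n IH] using (well_founded_induction lt_wf).
  intros F HF V HV x ->.
  assert (HVs : persistent (subst_val V s)) by now apply subst_val_persistent.
  destruct (classic (good Phi A (realized_types Phi (subst_val V s) (fun _ => True))))
    as [HW|HW].
  { apply forces_subst, forces_cover with (fun _ => True); auto. }
  assert (HX : exists X : list form -> Prop,
    (forall u, X u -> In u (realized_types Phi (subst_val V s) (fun _ => True))) /\
    forall w, In w (realized_types Phi (subst_val V s) (fun _ => True)) ->
      ~ tight Phi X w).
  { apply NNPP; intros Hn; apply HW; split.
    - intros u Hu; apply in_realized_types in Hu as (y & _ & <-); apply in_typ.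
      split; [exact HAPhi|]; apply forces_subst, HA; auto.
    - intros X HX; apply NNPP; intros Hn'; apply Hn; exists X; split; [exact HX|].
      intros w Hw Ht; apply Hn'; eauto. }
  destruct HX as (X & HX & Hnot).
  (* A stable node provides a tight predecessor for the empty set, so the offending [X] is
     nonempty. *)
  assert (Hne : exists y, X (typ Phi (subst_val V s) y)).
  { apply NNPP; intros Hn; destruct (stable_node F Phi _ x HVs) as (y & _ & Hy).
    apply (Hnot (typ Phi (subst_val V s) y)); [apply in_realized_types; eauto|].
    apply tight_typ; auto.
    intros u Hu; exfalso; apply Hn; pose proof (HX u Hu) as Hu'.
    apply in_realized_types in Hu' as (t & _ & <-); eauto. }
  set (D := fun y => X (typ Phi (subst_val V s) y)).
  set (U := ext_val D V).
  assert (HU : persistent U) by now apply ext_val_persistent.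
  assert (HUs : persistent (subst_val U s)) by now apply subst_val_persistent.
  assert (Hold : forall y B, forces (subst_val U s) (old y : ext F D) B <->
                             forces (subst_val V s) y B).
  { intros y B; apply forces_old; intros i z; apply forces_old; reflexivity. }
  assert (Htyp : forall y, typ Phi (subst_val U s) (old y : ext F D) =
                           typ Phi (subst_val V s) y)
    by (intros y; apply typ_eq; auto).
  (* Forcing at [x] agrees with forcing at its old copy, so the claim moves to the extended model,
     where fewer types are missing. *)
  apply forces_subst, Hold, forces_subst.
  eapply IH; [|apply HK; [exact HF | exact Hne] | exact HU | reflexivity].
  apply length_pfilter_lt with (typ Phi (subst_val U s) (glue : ext F D)).
  - intros u _ Hn (y & _ & <-); apply Hn; exists (old y : ext F D); auto.
  - apply typ_all_types.
  (* The type of [glue] is a tight predecessor of [X], hence it was not realized before. *)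
  - intros Hr; apply in_realized_types in Hr; apply (Hnot _ Hr).
    apply tight_typ; auto.
    + intros u Hu; pose proof (HX u Hu) as Hu'.
      apply in_realized_types in Hu' as (y & _ & <-).
      exists (old y : ext F D); split; [exists y; split; [exact Hu|apply le_refl] | auto].
    + intros [| |z] Hz; [destruct Hz | now left | right].
      destruct Hz as (y & Hy & Hyz).
      exists (old y : ext F D); split; [rewrite Htyp; exact Hy | exact Hyz].
  - intros Hn; apply Hn; eauto.
Qed.

Definition cover_admissible (L : form -> Prop) : Prop :=
  forall Phi A s, closed Phi -> In A Phi ->
  L (subst s A) -> L (subst s (cover Phi A)).

Lemma ext_closed_cover_admissible (K : frame -> Prop) :
  ext_closed K -> cover_admissible (logic_of K).
Proof. intros HK Phi A s HPhi HA H F HF; now apply cover_ext_closed with K. Qed.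

(** Asking for a model of [L], not for a frame validating [L], lets canonical models serve
    directly. *)
Lemma linear_cover_admissible (L : form -> Prop) :
  (forall B, ~ L B -> exists (F : frame) (V : nat -> F -> Prop) x,
     persistent V /\ linear_above x /\ ~ forces V x B /\
     forall C, L C -> forall y, forces V y C) ->
  cover_admissible L.
Proof.
  intros HL Phi A s HPhi HAPhi HA; apply NNPP; intros Hn.
  destruct (HL _ Hn) as (F & V & x & HV & Hlin & Hx & HLV).
  apply Hx, forces_subst, cover_linear; auto using subst_val_persistent.
  intros y; apply forces_subst; auto.
Qed.

(** * The individual logics *)

Definition logic (L : form -> Prop) : Prop :=
  (forall A, Int A -> L A) /\ (forall A B, L A -> L (A →' B) -> L B) /\
  (forall s A, L A -> L (subst s A)).

Lemma Int_plus_logic X : logic (Int_plus X).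
Proof.
  split; [|split]; [apply plus_Int | apply plus_mp | apply plus_subst].
Qed.

Lemma valid_subst F s A : valid F A -> valid F (subst s A).
Proof.
  intros H V HV x; apply forces_subst, H; now apply subst_val_persistent.
Qed.

Lemma valid_mp F A B : valid F A -> valid F (A →' B) -> valid F B.
Proof. intros HA HAB V HV x; apply (HAB V HV x x (le_refl _ x)), HA, HV. Qed.

Lemma logic_of_logic (K : frame -> Prop) : logic (logic_of K).
Proof.
  split; [|split].
  - intros A HA F _ V HV x; now apply Int_sound.
  - intros A B HA HAB F HF; eauto using valid_mp.
  - intros s A HA F HF; auto using valid_subst.
Qed.

Lemma logic_of_refutes (K : frame -> Prop) B :
  ~ logic_of K B -> exists (F : frame) (V : nat -> F -> Prop) x,
    K F /\ persistent V /\ ~ forces V x B.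
Proof.
  intros H; apply NNPP; intros Hn; apply H; intros F HF V HV x.
  apply NNPP; intros Hx; apply Hn; exists F, V, x; auto.
Qed.

(** The two new nodes lie below old ones, so the maximal nodes of the extended frame are the old
    maximal nodes. *)
Lemma M_cover_admissible n : cover_admissible (M n).
Proof.
  apply ext_closed_cover_admissible; intros F X (_ & Htop & Hmax) [x0 Hx0].
  assert (Hold : forall x : F, maximal x <-> maximal (old x : ext F X)).
  { intros x; split; intros H.
    - intros [| |y] Hy; simpl in *; try tauto; now rewrite (H y Hy).
    - intros y Hy; specialize (H (old y) Hy); congruence. }
  split; [|split].
  - exists root; intros y; exact I.
  - intros [| |x].
    + destruct (Htop x0) as (m & _ & Hm); exists (old m); split; [exact I | now apply Hold].
    + destruct (Htop x0) as (m & Hxm & Hm); exists (old m); split; [exists x0; auto|].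
      now apply Hold.
    + destruct (Htop x) as (m & Hxm & Hm); exists (old m); split; [exact Hxm|].
      now apply Hold.
  - intros l Hl Hlm.
    (* The default [x0] is never met, as the members of [l] are maximal and thus old. *)
    set (f := fun a : ext F X => match a with old x => x | _ => x0 end).
    assert (Hf : forall a, In a l -> a = old (f a)).
    { intros [| |x] Ha; [| |reflexivity]; specialize (Hlm _ Ha (old x0)).
      - discriminate (Hlm I).
      - assert (le (glue : ext F X) (old x0)) as H by (exists x0; split; [exact Hx0 | apply le_refl]).
        discriminate (Hlm H). }
    rewrite <- (length_map f); apply Hmax.
    + apply NoDup_map_NoDup_ForallPairs; [|exact Hl].
      intros a b Ha Hb E; rewrite (Hf a Ha), (Hf b Hb); congruence.
    + intros x Hx; apply in_map_iff in Hx as (a & <- & Ha).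
      apply Hold; rewrite <- (Hf a Ha); auto.
Qed.

Lemma G_cover_admissible n : cover_admissible (G n).
Proof.
  apply linear_cover_admissible; intros B HB.
  apply logic_of_refutes in HB as (F & V & x & HF & HV & Hx).
  exists F, V, x; split; [exact HV|]; split; [|split; [exact Hx|]].
  - intros y z _ _; apply HF.
  - intros C HC; now apply HC.
Qed.

(** In depth at most one every cone is a single point, hence linear. *)
Lemma Bd1_cover_admissible : cover_admissible (Bd 1).
Proof.
  apply linear_cover_admissible; intros B HB.
  apply logic_of_refutes in HB as (F & V & x & HF & HV & Hx).
  exists F, V, x; split; [exact HV|]; split; [|split; [exact Hx|]].
  - assert (Heq : forall y, le x y -> x = y).
    { intros y Hy; apply NNPP; intros Hn.
      enough (length [x; y] <= 1) by (simpl in *; lia).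
      apply HF; repeat constructor; auto. }
    intros y z Hy Hz; left; rewrite <- (Heq y Hy); exact Hz.
  - intros C HC; now apply HC.
Qed.

(** * Directed frames and [KC] *)

Definition directed (F : frame) : Prop := forall x y : F, exists z, le x z /\ le y z.

Lemma prime_and T A B : prime T -> T A -> T B -> T (A ∧' B).
Proof.
  intros [HT _] HA HB; apply HT; eapply cn_mp; [apply cn_hyp, HB|].
  eapply cn_mp; [apply cn_hyp, HA|]; apply cn_Int, Int_and_i.
Qed.

Lemma prime_mp T A B : prime T -> T A -> T (A →' B) -> T B.
Proof. intros [HT _] HA HAB; apply HT, cn_mp with A; now apply cn_hyp. Qed.

Lemma prime_consistent T A : prime T -> T A -> T (¬' A) -> False.
Proof.
  intros (HT & [C HC] & _) HA HnA; apply HC, HT.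
  apply cn_absurd with A; now apply cn_hyp.
Qed.

(** The finitely many members of [T] used in a derivation are merged into one conjunction. *)
Lemma cn_union T U C :
  prime T -> cn (fun D => T D \/ U D) C -> exists B, T B /\ cn U (B →' C).
Proof.
  intros HT H; induction H as [A [HA|HA]|A HA|A C _ (B1 & HB1 & H1) _ (B2 & HB2 & H2)].
  - exists A; split; [exact HA|]; apply cn_Int, Int_id.
  - exists (Var 0 →' Var 0); split; [apply (proj1 HT), cn_Int, Int_id|].
    now apply cn_weaken, cn_hyp.
  - exists (Var 0 →' Var 0); split; [apply (proj1 HT), cn_Int, Int_id|].
    now apply cn_weaken, cn_Int.
  - exists (B1 ∧' B2); split; [now apply prime_and|]; apply cn_deduction.
    assert (HB : cn (extend U (B1 ∧' B2)) (B1 ∧' B2)) by (apply cn_hyp; now right).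
    apply cn_mono with (U := extend U (B1 ∧' B2)) in H1; [|now left].
    apply cn_mono with (U := extend U (B1 ∧' B2)) in H2; [|now left].
    apply cn_mp with A.
    + refine (cn_mp _ _ _ _ H1); apply (cn_mp _ _ _ HB), cn_Int, Int_and_l.
    + refine (cn_mp _ _ _ _ H2); apply (cn_mp _ _ _ HB), cn_Int, Int_and_r.
Qed.

(** If [T] and [U] had no common prime extension, some [B] in [T] would have [¬' B] in [U]. But [T0]
    contains [¬' B] or [¬' ¬' B], contradicting [T] or [U]. *)
Lemma canonical_directed T0 (H0 : prime T0) :
  (forall A, T0 (¬' A ∨' ¬' ¬' A)) -> directed (canonical T0 H0).
Proof.
  intros HKC [T [HT HT0]] [U [HU HU0]].
  destruct (prime_extension (fun D => T D \/ U D) bot) as (W & HW & HTW & _).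
  - intros H; apply (cn_union T U bot HT) in H as (B & HB & HUB).
    assert (HnB : U (¬' B)).
    { apply (proj1 HU), cn_neg_intro; apply cn_mono with (U := extend U B) in HUB;
        [|now left].
      assert (Hbot : cn (extend U B) bot)
        by (apply (cn_mp _ B); [apply cn_hyp; now right | exact HUB]).
      apply cn_absurd with (Var 0); apply (cn_mp _ _ _ Hbot), cn_Int;
        [apply Int_and_l | apply Int_and_r]. }
    destruct (proj2 (proj2 H0) _ _ (HKC B)) as [H|H].
    + eapply (prime_consistent T); eauto.
    + eapply (prime_consistent U); eauto.
  - assert (HW0 : prime W /\ forall A, T0 A -> W A) by auto.
    exists (exist _ W HW0); split; intros A HA; apply HTW; auto.
Qed.

(** Turns the axiomatic [KC] into the logic of a class of frames, to which gluing applies. *)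
Lemma KC_logic_of_directed A : KC A <-> logic_of directed A.
Proof.
  split.
  - intros H F HF; induction H as [A HA| |A B _ IH1 _ IH2|s A _ IH].
    + intros V HV x; now apply Int_sound.
    + intros V HV x; simpl.
      destruct (classic (exists y, le x y /\ V 0 y)) as [(y & Hxy & Hy)|Hn].
      * right; intros z Hxz Hz; destruct (HF y z) as (t & Hyt & Hzt).
        exact (Hz t Hzt (HV 0 y t Hyt Hy)).
      * left; intros y Hxy Hy; eauto.
    + eauto using valid_mp.
    + auto using valid_subst.
  - intros H; apply NNPP; intros Hn; destruct (Int_plus_logic (¬' Var 0 ∨' ¬' ¬' Var 0))
      as (HI & Hmp & Hs).
    destruct (canonical_refutes KC A HI Hmp Hn) as (T0 & H0 & HL & HT0).
    apply HT0, (truth_lemma T0 H0 A (exist _ T0 (conj H0 (fun _ H => H)))).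
    apply H; [|apply cval_persistent]; apply canonical_directed; intros B.
    apply HL, (Hs (fun _ => B) _ (plus_ax _)).
Qed.

Lemma KC_cover_admissible : cover_admissible KC.
Proof.
  intros Phi A s HPhi HA; rewrite !KC_logic_of_directed; revert Phi A s HPhi HA.
  apply ext_closed_cover_admissible; intros F X HF [x0 Hx0].
  assert (Hup : forall a : ext F X, exists x : F, le a (old x : ext F X)).
  { intros [| |x]; [exists x0; exact I | exists x0 | exists x; apply le_refl].
    exists x0; split; [exact Hx0 | apply le_refl]. }
  intros a b; destruct (Hup a) as [x Hx], (Hup b) as [y Hy].
  destruct (HF x y) as (z & Hxz & Hyz); exists (old z : ext F X); split.
  - exact (le_trans _ a (old x) (old z) Hx Hxz).
  - exact (le_trans _ b (old y) (old z) Hy Hyz).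
Qed.

(** * Logics with linear canonical models *)

Lemma canonical_linear_cover_admissible (L : form -> Prop) :
  logic L ->
  (forall T0 T U : form -> Prop, prime T0 -> prime T -> prime U ->
    (forall A, L A -> T0 A) -> (forall A, T0 A -> T A) -> (forall A, T0 A -> U A) ->
    (forall A, T A -> U A) \/ (forall A, U A -> T A)) ->
  cover_admissible L.
Proof.
  intros (HI & Hmp & _) Hlin; apply linear_cover_admissible; intros B HB.
  destruct (canonical_refutes L B HI Hmp HB) as (T0 & H0 & HL & HT0).
  exists (canonical T0 H0), (cval T0 H0), (exist _ T0 (conj H0 (fun _ H => H))).
  split; [apply cval_persistent|]; split; [|split].
  - intros [T [HT HTT]] [U [HU HUU]] _ _; apply (Hlin T0); auto.
  - now rewrite truth_lemma.
  - intros C HC [T [HT HTT]]; apply truth_lemma; simpl; auto.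
Qed.

Lemma not_included (T U : form -> Prop) :
  ~ (forall A, T A -> U A) -> exists A, T A /\ ~ U A.
Proof.
  intros H; apply NNPP; intros Hn; apply H; intros A HA; apply NNPP; eauto.
Qed.

(** With [A] only in [T] and [B] only in [U], either disjunct of the linearity axiom in [T0] would
    move one of them into the other theory. *)
Lemma LC_cover_admissible : cover_admissible LC.
Proof.
  destruct (Int_plus_logic ((Var 0 →' Var 1) ∨' (Var 1 →' Var 0))) as (HI & Hmp & Hs).
  apply canonical_linear_cover_admissible; [apply Int_plus_logic|].
  intros T0 T U H0 HT HU HL HTT HUU; apply NNPP; intros Hn.
  apply not_or_and in Hn as [H1 H2].
  apply not_included in H1 as (A & HAT & HAU), H2 as (B & HBU & HBT).
  assert (H : T0 ((A →' B) ∨' (B →' A))).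
  { apply HL; exact (Hs (fun i => match i with 0 => A | _ => B end) _ (plus_ax _)). }
  apply H0 in H as [H|H].
  - apply HBT; now apply prime_mp with A; auto.
  - apply HAU; now apply prime_mp with B; auto.
Qed.

(* Above [T0], a theory other than [T0] contains every theory: if [B] in [T] but
   not in [T0], and [q] in [U] but not in [T], the axiom for [q] and
   [p := (B \/ ~q) \/ ((B \/ ~q) -> q)] puts [p] in [T0]. *)
Lemma Sm_above (T0 T U : form -> Prop) B :
  prime T0 -> prime T -> prime U -> (forall A, Sm A -> T0 A) ->
  (forall A, T0 A -> T A) -> (forall A, T0 A -> U A) ->
  T B -> ~ T0 B -> forall q, U q -> T q.
Proof.
  intros H0 HT HU HL HTT HUU HBT HB0 q HqU; apply NNPP; intros HqT.
  set (r := B ∨' ¬' q); set (p := r ∨' (r →' q)).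
  assert (Hax : Sm ((¬' q →' p) →' ((p →' q) →' p) →' p)).
  { exact (plus_subst _ (fun i => match i with 0 => p | _ => q end) _ (plus_ax _)). }
  (* Both antecedents of the axiom are intuitionistic theorems: [¬' q] yields [r], and [p →' q]
     yields [r →' q]; each is a disjunct of [p]. *)
  assert (Hp : T0 p).
  { apply prime_mp with ((p →' q) →' p); [exact H0| |
      apply prime_mp with (¬' q →' p); [exact H0| |exact (HL _ Hax)]];
      apply (proj1 H0), cn_Int, Int_complete; intros F V HV x y _; simpl.
    - intros Hy; right; intros z Hyz Hz; apply (Hy z Hyz); left; exact Hz.
    - intros Hy; left; right; exact Hy. }
  assert (HTr : T r).
  { apply (proj1 HT); eapply cn_mp; [apply cn_hyp, HBT | apply cn_Int, Int_or_l]. }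
  apply (proj2 (proj2 H0)) in Hp as [Hr|Hrq].
  - apply (proj2 (proj2 H0)) in Hr as [Hr|Hr]; [auto|].
    now apply (prime_consistent U q); auto.
  - apply HqT; apply prime_mp with r; auto.
Qed.

Lemma Sm_cover_admissible : cover_admissible Sm.
Proof.
  apply canonical_linear_cover_admissible; [apply Int_plus_logic|].
  intros T0 T U H0 HT HU HL HTT HUU.
  destruct (classic (forall A, T A -> T0 A)) as [H|H]; [auto|right].
  apply not_included in H as (B & HBT & HB0); now apply Sm_above with T0 B.
Qed.

(** * Deductive systems *)

(** Tree-shaped derivations allow direct induction; [drv_derives] identifies them with the
    sequences. *)
Inductive drv (S : system) (Gamma : list form) : form -> Prop :=
| drv_hyp A : In A Gamma -> drv S Gamma A
| drv_ax s C : ax S C -> drv S Gamma (subst s C)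
| drv_rule s r : rules S r ->
    (forall B, In B (map (subst s) (fst r)) -> drv S Gamma B) ->
    drv S Gamma (subst s (snd r)).

Lemma derivation_drv S Gamma l :
  derivation S Gamma l -> forall A, In A l -> drv S Gamma A.
Proof.
  intros Hl; assert (H : forall n l1 B l2, length l1 <= n -> l = l1 ++ B :: l2 -> drv S Gamma B).
  { induction n as [n IH] using (well_founded_induction lt_wf); intros l1 B l2 Hn E.
    destruct (Hl l1 B l2 E) as [H|[(s & C & HC & ->)|(s & r & Hr & HB & Hincl)]].
    - now apply drv_hyp.
    - now apply drv_ax.
    - rewrite HB; apply drv_rule; [exact Hr|]; intros D HD.
      apply Hincl, in_split in HD as (l3 & l4 & ->).
      rewrite length_app in Hn; simpl in Hn.
      apply (IH (length l3)) with l3 (l4 ++ B :: l2); [lia | lia|].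
      now rewrite E, <- app_assoc. }
  intros A HA; apply in_split in HA as (l1 & l2 & E); eapply H; [apply le_n | exact E].
Qed.

Lemma derivation_app S Gamma l1 l2 :
  derivation S Gamma l1 -> derivation S Gamma l2 -> derivation S Gamma (l1 ++ l2).
Proof.
  intros H1 H2 k1 B k2 E; apply app_eq_app in E as (l & [[E1 E2]|[E1 E2]]).
  - destruct l as [|C l]; simpl in E2.
    + rewrite app_nil_r in E1; subst k1; symmetry in E2.
      destruct (H2 [] B k2 E2) as [H|[H|(s & r & Hr & HB & Hincl)]]; auto.
      right; right; exists s, r; split; [exact Hr|]; split; [exact HB|].
      intros D HD; destruct (Hincl D HD).
    + injection E2 as <- ->; now apply (H1 k1 B l).
  - destruct (H2 l B k2 E2) as [H|[H|(s & r & Hr & HB & Hincl)]]; auto.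
    right; right; exists s, r; split; [exact Hr|]; split; [exact HB|].
    intros D HD; subst k1; apply in_app_iff; right; auto.
Qed.

Lemma derivation_snoc S Gamma l A :
  derivation S Gamma l ->
  (In A Gamma \/ (exists s C, ax S C /\ A = subst s C) \/
   (exists s r, rules S r /\ A = subst s (snd r) /\
      incl (map (subst s) (fst r)) l)) ->
  derivation S Gamma (l ++ [A]).
Proof.
  intros Hl HA  k1 B k2 E; destruct k2 as [|C k _] using rev_ind.
  - apply app_inj_tail in E as [<- <-]; exact HA.
  - rewrite app_comm_cons, app_assoc in E; apply app_inj_tail in E as [-> _].
    now apply (Hl k1 B k).
Qed.

Lemma drv_derives S Gamma A : drv S Gamma A <-> derives S Gamma A.
Proof.
  split.
  - intros H; induction H as [A HA|s C HC|s r Hr _ IH].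
    + exists []; apply derivation_snoc; [|now left].
      intros [] B l2 E; discriminate.
    + exists []; apply derivation_snoc; [|right; left; eauto].
      intros [] B l2 E; discriminate.
    + assert (H : exists l, derivation S Gamma l /\ incl (map (subst s) (fst r)) l).
      { induction (map (subst s) (fst r)) as [|B Bs IHBs].
        - exists []; split; [|apply incl_refl]; intros [] B l2 E; discriminate.
        - destruct IHBs as (l & Hl & Hincl); [intros; apply IH; now right|].
          destruct (IH B (or_introl eq_refl)) as [k Hk].
          exists ((k ++ [B]) ++ l); split; [now apply derivation_app|].
          apply incl_cons; [|now apply incl_appr].
          rewrite !in_app_iff; simpl; tauto. }
      destruct H as (l & Hl & Hincl); exists l; apply derivation_snoc; [exact Hl|].
      right; right; exists s, r; auto.
  - intros [l Hl]; apply (derivation_drv S Gamma _ Hl), in_app_iff; right; now left.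
Qed.

Lemma drv_cut S Gamma Delta A :
  (forall B, In B Delta -> drv S Gamma B) -> drv S Delta A -> drv S Gamma A.
Proof.
  intros H HA; induction HA as [A HA|s C HC|s r Hr _ IH]; auto using drv_ax, drv_rule.
Qed.

Lemma drv_mono S S' Gamma A :
  (forall B, ax S B -> ax S' B) -> (forall r, rules S r -> rules S' r) ->
  drv S Gamma A -> drv S' Gamma A.
Proof.
  intros Hax Hr H; induction H as [A HA|s C HC|s r H _ IH];
    auto using drv_hyp, drv_ax, drv_rule.
Qed.

(** * Admissible rules and extensions of the completion *)

Lemma thms_mp_system L HL A : logic L -> thms (mp_system L HL) A <-> L A.
Proof.
  intros (_ & Hmp & Hs); unfold thms; rewrite <- drv_derives; split.
  - intros H; induction H as [A []|s C HC|s r Hr _ IH]; [now apply Hs|].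
    simpl in Hr; subst r; apply Hmp with (s 0); apply IH; simpl; auto.
  - intros H; rewrite <- (subst_Var A); now apply drv_ax.
Qed.

Lemma admissible_mp_system L HL r :
  logic L ->
  (forall s, (forall B, In B (fst r) -> L (subst s B)) -> L (subst s (snd r))) ->
  admissible (mp_system L HL) r.
Proof.
  intros HLog Hr A; rewrite thms_mp_system by exact HLog; destruct HLog as (_ & Hmp & Hs).
  unfold thms; rewrite <- drv_derives; split.
  - intros H; induction H as [A []|s C HC|s r' Hr' _ IH]; [now apply Hs|].
    simpl in Hr'; destruct Hr' as [Hr'|Hr']; subst r'.
    + apply Hmp with (s 0); apply IH; simpl; auto.
    + apply Hr; intros B HB; now apply IH, in_map.
  - intros H; rewrite <- (subst_Var A); now apply drv_ax.
Qed.

(** One application of the added rule derives the conclusion in [add_rule S r], and admissibility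
    brings this theorem back to [S]. *)
Lemma admissible_drv S s r :
  admissible S r -> (forall B, In B (fst r) -> drv S [] (subst s B)) ->
  drv S [] (subst s (snd r)).
Proof.
  intros Hr H; apply drv_derives, (proj1 (Hr _)), drv_derives.
  apply (drv_rule (add_rule S r)); [now right|].
  intros B HB; apply in_map_iff in HB as (C & <- & HC).
  apply (drv_mono S (add_rule S r)); [auto | now left | now apply H].
Qed.

Lemma bigor_elim (T : form -> Prop) l C :
  (forall A, Int A -> T A) -> (forall A B, T A -> T (A →' B) -> T B) ->
  (forall A, In A l -> T (A →' C)) -> T (bigor l →' C).
Proof.
  intros HI Hmp H; induction l as [|A l IH]; simpl.
  - apply HI, Int_complete; intros F V HV x y _ [H1 H2] ; exfalso.
    exact (H2 y (le_refl _ y) H1).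
  - apply (Hmp _ _ (IH (fun B HB => H B (or_intror HB)))).
    apply (Hmp _ _ (H A (or_introl eq_refl))), HI, Int_or_e.
Qed.

Lemma Int_bigand_elim l A : In A l -> Int (bigand l →' A).
Proof.
  intros HA; apply Int_complete; intros F V HV x y _ H.
  rewrite forces_bigand in H; auto.
Qed.

Lemma bigand_intro (T : form -> Prop) l :
  (forall A, Int A -> T A) -> (forall A B, T A -> T (A →' B) -> T B) ->
  (forall A, In A l -> T A) -> T (bigand l).
Proof.
  intros HI Hmp H; induction l as [|A l IH]; simpl; [apply HI, Int_id|].
  apply (Hmp (bigand l)); [apply IH; intros B HB; apply H; now right|].
  apply (Hmp A); [apply H; now left | apply HI, Int_and_i].
Qed.

Lemma Int_discharge A B C : Int (C →' (A →' C →' B) →' A →' B).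
Proof.
  apply Int_complete; intros F V HV x y _ HC z Hyz H t Hzt HA.
  apply (H t Hzt HA t (le_refl _ t)).
  apply forces_persistent with y; eauto using le_trans.
Qed.

Lemma extension_structurally_complete L HL S :
  logic L -> cover_admissible L ->
  extension (structural_completion (mp_system L HL)) S -> structurally_complete S.
Proof.
  intros HLog HC Hext [Gamma C] Hr; apply drv_derives; simpl.
  pose proof HLog as (HI & HLmp & HLs).
  set (S0 := structural_completion (mp_system L HL)) in *.
  (* [S] may have any axioms and rules, so modus ponens and the passage from [A] to its cover are
     recovered in it as rules admissible for [L]. *)
  assert (HS0 : forall r, admissible (mp_system L HL) r -> drv S (fst r) (snd r)).
  { intros r H; apply drv_derives, Hext, drv_derives.
    rewrite <- (subst_Var (snd r)); apply (drv_rule S0); [exact H|].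
    intros B HB; apply drv_hyp; rewrite <- (map_id (fst r)).
    erewrite map_ext; [exact HB | intros D; symmetry; apply subst_Var]. }
  assert (HSL : forall Delta A, L A -> drv S Delta A).
  { intros Delta A HA; apply drv_cut with []; [intros B []|].
    apply drv_derives, Hext, drv_derives; rewrite <- (subst_Var A).
    now apply (drv_ax S0). }
  assert (HSI : forall Delta A, Int A -> drv S Delta A) by auto.
  assert (HSmp : forall Delta A B, drv S Delta A -> drv S Delta (A →' B) -> drv S Delta B).
  { intros Delta A B HA HAB; apply drv_cut with [A; A →' B].
    - intros D [<-|[<-|[]]]; assumption.
    - apply (HS0 ([A; A →' B], B)); apply admissible_mp_system; [exact HLog|].
      intros s H; apply HLmp with (subst s A); [|change (L (subst s (A →' B)))];
        apply H; simpl; auto. }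
  set (A := bigand Gamma); set (Phi := subformulas A).
  assert (HPhi : closed Phi) by apply subformulas_closed.
  assert (HAPhi : In A Phi) by apply subformulas_self.
  assert (HA : drv S Gamma A) by (apply bigand_intro; auto using drv_hyp; apply HSmp).
  assert (Hcover : drv S Gamma (cover Phi A)).
  { apply drv_cut with [A]; [intros B [<-|[]]; exact HA|].
    apply (HS0 ([A], cover Phi A)); apply admissible_mp_system; [exact HLog|].
    intros s H; apply HC; auto; apply H; now left. }
  apply (HSmp _ _ _ Hcover), (bigor_elim (drv S Gamma)); [apply HSI | apply HSmp|].
  intros P HP; apply in_map_iff in HP as (W & <- & HW).
  apply in_pfilter in HW as [HWT HW]; apply sublists_incl in HWT.
  set (s := unifier Phi W).
  (* The unifier makes [PW], hence [A] and every premise, a theorem of [L]; admissibility of the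
     rule in [S] then gives the substituted conclusion. *)
  assert (HsC : drv S [] (subst s C)).
  { apply (admissible_drv S s (Gamma, C) Hr); simpl; intros B HB; apply HSL.
    apply HLmp with (subst s A); [|exact (HLs s _ (HI _ (Int_bigand_elim _ _ HB)))].
    apply HLmp with (subst s (PW Phi W)).
    - apply HI; now apply unifier_unifies with A.
    - exact (HLs s _ (HI _ (PW_implies Phi A W HAPhi HW))). }
  (* Projectivity undoes the substitution under the assumption [PW]. *)
  apply HSmp with (PW Phi W →' subst s C →' C); [apply HSI, unifier_projective|].
  apply HSmp with (subst s C); [apply drv_cut with []; [intros B [] | exact HsC]|].
  apply HSI, Int_discharge.
Qed.

(** The completion itself is covered as a trivial extension of itself. *)
Lemma completion_hereditarily_structurally_complete L HL :
  logic L -> cover_admissible L ->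
  hereditarily_structurally_complete (structural_completion (mp_system L HL)).
Proof.
  intros HLog HC; split; [|intros S HS];
    apply (extension_structurally_complete L HL); auto; now intros Gamma A.
Qed.

Theorem corollary5p2 :
  hereditarily_structurally_complete (structural_completion KC_system) /\
  (forall n : nat, 1 <= n ->
    hereditarily_structurally_complete (structural_completion (M_system n))) /\
  hereditarily_structurally_complete (structural_completion (Bd_system 1)) /\
  (forall n : nat, 1 <= n ->
    hereditarily_structurally_complete (structural_completion (G_system n))) /\
  hereditarily_structurally_complete (structural_completion LC_system) /\
  hereditarily_structurally_complete (structural_completion Sm_system).
Proof.
  refine (conj _ (conj _ (conj _ (conj _ (conj _ _))))); intros;
    apply completion_hereditarily_structurally_complete.
  - apply Int_plus_logic.
  - exact KC_cover_admissible.
  - apply logic_of_logic.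
  - apply M_cover_admissible.
  - apply logic_of_logic.
  - exact Bd1_cover_admissible.
  - apply logic_of_logic.
  - apply G_cover_admissible.
  - apply Int_plus_logic.
  - exact LC_cover_admissible.
  - apply Int_plus_logic.
  - exact Sm_cover_admissible.
Qed.
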